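(* Let $L$ be a countable continuous signature and let $T$ be a $\forall\exists$-axiomatizable $L$-theory with the joint embedding property. Then exactly one of the following happens: (1) For every enforceable property $P$ (of $L$-structures), there are continuum many pairwise nonisomorphic models of $T$ with property $P$. (2) $T$ has an enforceable model.
   Context: $L$ is one-sorted of diameter at most $1$ with $[0,1]$-valued predicates; structures are complete. $T$ has the joint embedding property (JEP) if any two models of $T$ embed into a common model of $T$. Game with respect to $T$ (satisfiable). Let $C$ be a countably infinite set of new constant symbols and $L(C)=L\cup C$. A restricted formula is one using only the connectives $x\mapsto x/2$, $\neg x=1-x$ and truncated addition $x\dotplus y=\min(x+y,1)$. A condition is a finite set $p$ of expressions $\varphi<r$, with $\varphi$ a quantifier-free restricted $L(C)$-sentence and $r\in\mathbb R$, such that $T\cup p$ is satisfiable. Players $\forall$ and $\exists$ alternately play conditions $p_0\subseteq p_1\subseteq p_2\subseteq\cdots$ ($\forall$ first; each move contains the previous one) for $\omega$ steps; let $\bar p=\bigcup_i p_i$. The play is definitive if for every atomic $L(C)$-sentence $\varphi$ there is a unique $r\in[0,1]$ with $T\cup\bar p\models\varphi=r$; then $\bar p$ determines an $L(C)$-prestructure on the algebra of closed $L(C)$-terms, whose completion is the compiled structure $A^+(\bar p)$, with $L$-reduct $A(\bar p)$. A property $P$ is enforceable if $\exists$ has a strategy guaranteeing, whatever $\forall$ plays, that the play is definitive and the compiled structure has $P$ (for a property of $L$-structures: that $A(\bar p)$ has $P$). An enforceable model of $T$ is a model $A$ of $T$ such that the property ''the $L$-reduct of the compiled structure is isomorphic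 to $A$'' is enforceable. *)

(* Defs.v *)
From HB Require Import structures.
From mathcomp Require Import all_boot all_order all_algebra.
From mathcomp Require Import boolp classical_sets functions cardinality reals.
From mathcomp Require Import topology normedtype.
Set Implicit Arguments.
Unset Strict Implicit.
Unset Printing Implicit Defensive.
Import Order.TTheory GRing.Theory Num.Theory.
Import numFieldNormedType.Exports.
Local Open Scope classical_set_scope.
Local Open Scope ring_scope.

(* A modulus [D] controls a map [f] by: if all coordinate distances are
   [< D eps], then the values are within [eps]. The metric is not a symbol. *)
Record signature (R : realType) := Signature {
  fsym : Type;
  farity : fsym -> nat;
  fmod : fsym -> R -> R;
  fmod_gt0 : forall f eps, 0 < eps -> 0 < fmod f eps;
  psym : Type;
  parity : psym -> nat;
  pmod : psym -> R -> R;
  pmod_gt0 : forall P eps, 0 < eps -> 0 < pmod P eps }.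

Arguments farity {R s}.
Arguments fmod {R s}.
Arguments parity {R s}.
Arguments pmod {R s}.

Definition countable_signature (R : realType) (L : signature R) : Prop :=
  countable [set: fsym L] /\ countable [set: psym L].

(* Bare interpretations, subject to no axioms. *)
Record interp (R : realType) (L : signature R) := Interp {
  carrier :> Type;
  dist : carrier -> carrier -> R;
  fint : forall f : fsym L, ('I_(farity f) -> carrier) -> carrier;
  pint : forall P : psym L, ('I_(parity P) -> carrier) -> R }.

Arguments dist {R L i}.
Arguments fint {R L i}.
Arguments pint {R L i}.

Record is_prestructure (R : realType) (L : signature R) (M : interp L) : Prop :=
  IsPrestructure {
  nonempty : inhabited M;
  dist_ge0 : forall x y : M, 0 <= dist x y;
  dist_le1 : forall x y : M, dist x y <= 1;
  distxx : forall x : M, dist x x = 0;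
  dist_sym : forall x y : M, dist x y = dist y x;
  dist_triangle : forall x y z : M, dist x z <= dist x y + dist y z;
  fint_unif : forall (f : fsym L) (x y : 'I_(farity f) -> M) (eps : R), 0 < eps ->
    (forall i, dist (x i) (y i) < fmod f eps) -> dist (fint f x) (fint f y) <= eps;
  pint_ge0 : forall (P : psym L) (x : 'I_(parity P) -> M), 0 <= pint P x;
  pint_le1 : forall (P : psym L) (x : 'I_(parity P) -> M), pint P x <= 1;
  pint_unif : forall (P : psym L) (x y : 'I_(parity P) -> M) (eps : R), 0 < eps ->
    (forall i, dist (x i) (y i) < pmod P eps) -> `|pint P x - pint P y| <= eps }.

Definition is_complete (R : realType) (L : signature R) (M : interp L) : Prop :=
  forall u : nat -> M,
    (forall eps : R, 0 < eps -> exists N : nat, forall m n : nat,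
       (N <= m)%N -> (N <= n)%N -> dist (u m) (u n) < eps) ->
    exists l : M, forall eps : R, 0 < eps -> exists N : nat, forall n : nat,
       (N <= n)%N -> dist (u n) l < eps.

Record structure (R : realType) (L : signature R) := Structure {
  sinterp :> interp L;
  struct_pre : is_prestructure sinterp;
  struct_sep : forall x y : sinterp, dist x y = 0 -> x = y;
  struct_complete : is_complete sinterp }.

Definition embedding (R : realType) (L : signature R) (A B : interp L)
    (h : A -> B) : Prop :=
  [/\ forall x y : A, dist (h x) (h y) = dist x y,
      forall (f : fsym L) (x : 'I_(farity f) -> A),
        h (fint f x) = fint f (fun i => h (x i)) &
      forall (P : psym L) (x : 'I_(parity P) -> A),
        pint P (fun i => h (x i)) = pint P x].

Definition isomorphic (R : realType) (L : signature R) (A B : interp L) : Prop :=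
  exists h : A -> B, bijective h /\ embedding h.

Definition is_completion (R : realType) (L : signature R)
    (A : interp L) (M : structure L) : Prop :=
  exists h : A -> M, embedding h /\
    forall (y : M) (eps : R), 0 < eps -> exists x : A, dist (h x) y < eps.

(* [term L n] and [formula L n] have their free variables among [x_0..x_(n-1)];
   in a quantifier body, [x_0] is the bound variable and the others are shifted. *)
Inductive term (R : realType) (L : signature R) (n : nat) : Type :=
| Var of 'I_n
| App (f : fsym L) of ('I_(farity f) -> term L n).

Inductive atom (R : realType) (L : signature R) (n : nat) : Type :=
| Dist of term L n & term L n
| Pred (P : psym L) of ('I_(parity P) -> term L n).

Arguments Var {R L n}.
Arguments App {R L n}.
Arguments Dist {R L n}.
Arguments Pred {R L n}.

Definition unit_cube (R : realType) (k : nat) : set 'rV[R]_k :=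
  [set v | forall i, 0 <= v ord0 i <= 1].

Record connective (R : realType) (k : nat) := Connective {
  cfun :> 'rV[R]_k -> R;
  cfun_cont : {within @unit_cube R k, continuous cfun};
  cfun_01 : forall v, @unit_cube R k v -> 0 <= cfun v <= 1 }.

Inductive formula (R : realType) (L : signature R) : nat -> Type :=
| Atom n of atom L n : formula L n
| Conn n k of connective R k & ('I_k -> formula L n) : formula L n
| Sup n of formula L n.+1 : formula L n
| Inf n of formula L n.+1 : formula L n.

Definition env_cons (T : Type) (n : nat) (a : T) (e : 'I_n -> T) (i : 'I_n.+1) : T :=
  if unlift ord0 i is Some j then e j else a.

Fixpoint eval_term (R : realType) (L : signature R) (M : interp L) (n : nat)
    (e : 'I_n -> M) (t : term L n) : M :=
  match t with
  | Var i => e i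
  | App f ts => fint f (fun i => eval_term e (ts i))
  end.

Definition eval_atom (R : realType) (L : signature R) (M : interp L) (n : nat)
    (e : 'I_n -> M) (a : atom L n) : R :=
  match a with
  | Dist t s => dist (eval_term e t) (eval_term e s)
  | Pred P ts => pint P (fun i => eval_term e (ts i))
  end.

Fixpoint eval (R : realType) (L : signature R) (M : interp L) (n : nat)
    (phi : formula L n) : ('I_n -> M) -> R :=
  match phi in formula _ n return ('I_n -> M) -> R with
  | Atom n a => fun e => eval_atom e a
  | Conn n k u phis => fun e => u (\row_i eval (phis i) e)
  | Sup n psi => fun e => sup [set eval psi (env_cons a e) | a in [set: M]]
  | Inf n psi => fun e => inf [set eval psi (env_cons a e) | a in [set: M]]
  end.

Definition empty_env (T : Type) (i : 'I_0) : T :=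
  match notF (ltn_ord i) with end.

Definition sentence (R : realType) (L : signature R) := formula L 0.

(* A sentence [sigma] in a theory stands for the condition [sigma = 0]. *)
Definition models (R : realType) (L : signature R) (T : set (sentence L))
    (M : interp L) : Prop :=
  forall sigma, T sigma -> eval sigma (@empty_env M) = 0.

Fixpoint quantifier_free (R : realType) (L : signature R) (n : nat)
    (phi : formula L n) : Prop :=
  match phi with
  | Atom _ _ => True
  | Conn _ _ _ phis => forall i, quantifier_free (phis i)
  | Sup _ _ => False
  | Inf _ _ => False
  end.

Fixpoint sups (R : realType) (L : signature R) (m n : nat) :
    formula L (m + n) -> formula L n :=
  if m is m'.+1 then fun phi => sups (m := m') (Sup phi) else id.

Fixpoint infs (R : realType) (L : signature R) (m n : nat) :
    formula L (m + n) -> formula L n :=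
  if m is m'.+1 then fun phi => infs (m := m') (Inf phi) else id.

Definition forall_exists (R : realType) (L : signature R) (sigma : sentence L) : Prop :=
  exists (m k : nat) (phi : formula L (k + (m + 0))),
    quantifier_free phi /\ sigma = sups (infs phi).

Definition forall_exists_axiomatizable (R : realType) (L : signature R)
    (T : set (sentence L)) : Prop :=
  exists T' : set (sentence L), T' `<=` @forall_exists R L /\
    forall M : structure L, models T' M <-> models T M.

Definition satisfiable (R : realType) (L : signature R) (T : set (sentence L)) : Prop :=
  exists M : structure L, models T M.

Definition JEP (R : realType) (L : signature R) (T : set (sentence L)) : Prop :=
  forall A B : structure L, models T A -> models T B ->
    exists D : structure L, models T D /\
      (exists f : A -> D, embedding f) /\ (exists g : B -> D, embedding g).

(* [L(C)], the new constants being indexed by [nat]. *)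
Definition add_const (R : realType) (L : signature R) : signature R :=
  @Signature R (fsym L + nat)%type
    (fun f => match f with inl f => farity f | inr _ => 0%N end)
    (fun f => match f with inl f => fmod f | inr _ => fun=> 1 end)
    (fun f => match f with inl f => @fmod_gt0 R L f | inr _ => fun _ _ => ltr01 end)
    (psym L) parity pmod (@pmod_gt0 R L).

Definition reduct_interp (R : realType) (L : signature R)
    (M : interp (add_const L)) : interp L :=
  @Interp R L M dist (fun f => @fint R (add_const L) M (inl f))
    (@pint R (add_const L) M).

Lemma reduct_pre (R : realType) (L : signature R) (M : interp (add_const L)) :
  is_prestructure M -> is_prestructure (reduct_interp M).
Proof.
move=> preM; case: (preM) => *; split=> //.
by move=> f x y eps; exact: (@fint_unif _ _ _ preM (inl f)).
Qed.

Definition reduct (R : realType) (L : signature R) (M : structure (add_const L)) :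
    structure L :=
  @Structure R L (reduct_interp M) (reduct_pre (struct_pre M))
    (@struct_sep R _ M) (@struct_complete R _ M).

(* Restricted formulas without quantifiers; only these occur in conditions. *)
Inductive rformula (R : realType) (L : signature R) (n : nat) : Type :=
| RAtom of atom L n
| RHalf of rformula L n
| RNeg of rformula L n
| RPlus of rformula L n & rformula L n.

Fixpoint eval_r (R : realType) (L : signature R) (M : interp L) (n : nat)
    (e : 'I_n -> M) (phi : rformula L n) : R :=
  match phi with
  | RAtom a => eval_atom e a
  | RHalf phi => eval_r e phi / 2
  | RNeg phi => 1 - eval_r e phi
  | RPlus phi psi => Num.min (eval_r e phi + eval_r e psi) 1
  end.

(* The pair [(phi, r)] stands for the expression [phi < r]. *)
Definition expr (R : realType) (L : signature R) : Type :=
  (rformula (add_const L) 0 * R)%type.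

Definition models_with (R : realType) (L : signature R) (T : set (sentence L))
    (p : set (expr L)) (M : structure (add_const L)) : Prop :=
  models T (reduct M) /\ forall phi r, p (phi, r) -> eval_r (@empty_env M) phi < r.

Definition condition (R : realType) (L : signature R) (T : set (sentence L))
    (p : set (expr L)) : Prop :=
  finite_set p /\ exists M : structure (add_const L), models_with T p M.

Definition entails_eq (R : realType) (L : signature R) (T : set (sentence L))
    (p : set (expr L)) (a : atom (add_const L) 0) (r : R) : Prop :=
  forall M : structure (add_const L), models_with T p M ->
    eval_atom (@empty_env M) a = r.

Definition definitive (R : realType) (L : signature R) (T : set (sentence L))
    (p : set (expr L)) : Prop :=
  forall a : atom (add_const L) 0, exists! r : R, 0 <= r <= 1 /\ entails_eq T p a r.

(* The value at [a] of a definitive [p]; irrelevant when [p] is not definitive. *)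
Definition atom_value (R : realType) (L : signature R) (T : set (sentence L))
    (p : set (expr L)) (a : atom (add_const L) 0) : R :=
  xget 0 [set r : R | 0 <= r <= 1 /\ entails_eq T p a r].

Definition term_interp (R : realType) (L : signature R) (T : set (sentence L))
    (p : set (expr L)) : interp (add_const L) :=
  @Interp R (add_const L) (term (add_const L) 0)
    (fun t s => atom_value T p (Dist t s))
    App
    (fun P ts => atom_value T p (Pred P ts)).

(* Completions being unique only up to isomorphism, properties of structures
   are required to be isomorphism invariant. *)
Record property (R : realType) (L : signature R) := Property {
  holds :> structure L -> Prop;
  holds_iso : forall A B : structure L, isomorphic A B -> holds A -> holds B }.

Lemma isomorphic_sym (R : realType) (L : signature R) (A B : interp L) :
  isomorphic A B -> isomorphic B A.
Proof.
move=> [h [[g hK gK] [hd hf hp]]]; exists g; split; first by exists h.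
split=> [x y|f x|P x].
- by rewrite -hd !gK.
- apply: (can_inj hK); rewrite hf gK; congr fint.
  by apply: funext => i; rewrite gK.
- rewrite -hp; congr pint; by apply: funext => i; rewrite gK.
Qed.

Lemma isomorphic_trans (R : realType) (L : signature R) (A B C : interp L) :
  isomorphic A B -> isomorphic B C -> isomorphic A C.
Proof.
move=> [h [hb [hd hf hp]]] [g [gb [gd gf gp]]].
exists (g \o h); split; first exact: bij_comp.
split=> [x y|f x|P x] /=; first by rewrite gd hd.
- by rewrite hf gf.
- by rewrite gp hp.
Qed.

Lemma isomorphic_reduct (R : realType) (L : signature R)
    (A B : structure (add_const L)) :
  isomorphic A B -> isomorphic (reduct A) (reduct B).
Proof.
move=> [h [hb [hd hf hp]]]; exists h; split=> //; split=> //.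
by move=> f x; exact: (hf (inl f)).
Qed.

Definition reduct_property (R : realType) (L : signature R) (P : property L) :
    property (add_const L) :=
  @Property R (add_const L) (fun M => P (reduct M))
    (fun A B AB => holds_iso (isomorphic_reduct AB)).

Definition isomorphic_to (R : realType) (L : signature R) (A : structure L) :
    property L :=
  @Property R L (fun M => isomorphic M A)
    (fun M N MN => isomorphic_trans (isomorphic_sym MN)).

(* A play is a sequence of sets of expressions; player forall makes the moves
   of even index, player exists those of odd index. *)
Definition legal_move (R : realType) (L : signature R) (T : set (sentence L))
    (p : nat -> set (expr L)) (n : nat) : Prop :=
  condition T (p n) /\ forall m, n = m.+1 -> p m `<=` p n.

(* A strategy maps the finite sequence of all moves made so far to a move. *)
Definition strategy (R : realType) (L : signature R) : Type :=
  seq (set (expr L)) -> set (expr L).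

Definition follows (R : realType) (L : signature R) (s : strategy L)
    (p : nat -> set (expr L)) : Prop :=
  forall n, odd n -> p n = s (mkseq p n).

(* The first clause makes the strategy legal: it answers legally in any
   position reached by legal moves. *)
Definition winning (R : realType) (L : signature R) (T : set (sentence L))
    (P : property (add_const L)) (s : strategy L) : Prop :=
  forall p : nat -> set (expr L), follows s p ->
    (forall n, odd n -> (forall m, (m < n)%N -> legal_move T p m) ->
       legal_move T p n) /\
    ((forall n, legal_move T p n) ->
       let pbar := \bigcup_n p n in
       definitive T pbar /\
       exists M : structure (add_const L),
         is_completion (term_interp T pbar) M /\ P M).

Definition enforceable (R : realType) (L : signature R) (T : set (sentence L))
    (P : property (add_const L)) : Prop :=
  exists s : strategy L, winning T P s.

Definition enforceable_model (R : realType) (L : signature R)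
    (T : set (sentence L)) (A : structure L) : Prop :=
  models T A /\ enforceable T (reduct_property (isomorphic_to A)).

Definition continuum_many (R : realType) (L : signature R)
    (Q : structure L -> Prop) : Prop :=
  exists F : (nat -> bool) -> structure L,
    (forall x, Q (F x)) /\ (forall x y, x <> y -> ~ isomorphic (F x) (F y)).

(* Main.v *)
Require Import Defs.
From mathcomp Require Import all_boot all_order all_algebra.
From mathcomp Require Import boolp classical_sets functions cardinality reals set_interval.
From mathcomp Require Import topology normedtype sequences.
From mathcomp Require Import zify lra.
(* [topology] also exports a constant [eval]. *)
Import Defs.
Set Implicit Arguments.
Unset Strict Implicit.
Unset Printing Implicit Defensive.
Import Order.TTheory GRing.Theory Num.Theory.
Import numFieldNormedType.Exports.
Local Open Scope classical_set_scope.
Local Open Scope ring_scope.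

(** The game is a Banach-Mazur game on the space of models of [T] with named
    constants, where conditions are basic open sets.  Call a condition [q]
    (n, e)-isolating if any two conditions forcing [q], up to renaming of the
    constants, have models that amalgamate with the first [n] constants of the
    two copies of [q] within distance [e] of each other.

    If every condition extends to an isolating one, for all (n, e), the
    compiled structures of generic plays are the analogue of atomic models, and
    an approximate back-and-forth (started by the joint embedding property)
    shows that any two of them are isomorphic: this is the enforceable model.

    Otherwise some condition has no isolating extension for a fixed (n, e), so
    every condition below it splits into two extensions whose first [n]
    constants stay apart in every common model.  Interleaving these splittings
    with a strategy enforcing [P] gives a binary tree of plays.  An isomorphism
    class of compiled structures contains only countably many branches, because
    structures are separable and the constants of distinct branches are
    separated; hence there are continuum many classes.

    Both cases use that a play meeting countably many suitable dense sets
    compiles to a model of the forall-exists theory [T]. *)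

(** * Reals and connectives *)

Lemma le_eps (R : realType) (x y : R) : (forall e : R, 0 < e -> x <= y + e) -> x <= y.
Proof. by move=> h; apply/ler_addgt0Pr. Qed.

Lemma all_enum (J : finType) (X : Type) (F : J -> X) (P : pred X) :
  all P [seq F j | j <- enum J] <-> forall j, P (F j).
Proof.
rewrite (all_map F P (enum J)); split=> [/allP h j|h]; last by apply/allP => j _; exact: h.
by apply: h; rewrite mem_enum.
Qed.

Lemma ord_bound (n : nat) (P : 'I_n -> nat -> Prop) :
  (forall i, exists N, forall k, (N <= k)%N -> P i k) ->
  exists N, forall k, (N <= k)%N -> forall i, P i k.
Proof.
move=> /choice [F FP]; exists (\max_i F i)%N => k hk i.
by apply: FP; apply: leq_trans hk; exact: leq_bigmax.
Qed.

Lemma ord_gt0_bound (R : realType) (n : nat) (P : 'I_n -> R -> Prop) :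
  (forall i, exists2 d, 0 < d & forall e, e <= d -> P i e) ->
  exists2 d : R, 0 < d & forall i, P i d.
Proof.
elim: n P => [|n IH] P h; first by exists 1 => // -[].
have [d d0 hd] := IH (fun i e => forall e', e' <= e -> P (lift ord0 i) e')
  (fun i => let: ex_intro2 d d0 hd := h (lift ord0 i) in
    ex_intro2 _ _ d d0 (fun e ed e' e'e => hd e' (le_trans e'e ed))).
have [d1 d10 hd1] := h ord0.
exists (Num.min d d1); first by rewrite lt_min d0.
move=> i; case: (unliftP ord0 i) => [j ->|->]; last by apply: hd1; rewrite ge_min lexx orbT.
by apply: hd; rewrite ge_min lexx.
Qed.

Lemma real_cauchy (R : realType) (u : nat -> R) :
  (forall e : R, 0 < e -> exists N, forall m n, (N <= m)%N -> (N <= n)%N ->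
     `|u m - u n| < e) ->
  exists l, forall e : R, 0 < e -> exists N, forall n, (N <= n)%N -> `|u n - l| < e.
Proof.
move=> h.
have cu : cvgn u.
  apply/cauchy_cvgP; apply: cauchy_exP => e e0; have [N hN] := h e e0.
  by exists (u N); exists N => // n /= Nn; exact: hN.
exists (limn u) => e e0.
have [N _ hN] : \forall n \near \oo, `|limn u - u n| < e.
  by move/cvgrPdist_lt: cu; apply.
by exists N => n Nn; rewrite distrC; exact: hN.
Qed.

(** Heine-Cantor on the compact cube, through the near-covering form of compactness: a radius
    tending to [0^'+] that eventually works near each point eventually works on the whole cube. *)
Lemma connective_unif (R : realType) (k : nat) (u : connective R k) (e : R) :
  0 < e -> exists2 d, 0 < d & forall v w, @unit_cube R k v -> @unit_cube R k w ->
    (forall i, `|v ord0 i - w ord0 i| < d) -> `|u v - u w| < e.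
Proof.
move=> e0.
have cube : compact (@unit_cube R k).
  have := @rV_compact R k (fun=> `[0, 1]%classic) (fun=> @segment_compact R 0 1).
  congr compact; apply: eq_set => v; apply: propext; split=> h i; have := h i;
    by rewrite /= in_itv.
have nc := (compact_near_coveringP _).1 cube.
pose P (d : R) (v : 'rV[R]_k) := unit_cube v -> forall w, unit_cube w ->
  (forall i, `|v ord0 i - w ord0 i| < d) -> `|u v - u w| < e.
have : \forall d \near 0^'+, @unit_cube R k `<=` P d.
  apply: nc => v cv.
  have := cfun_cont (c := u); rewrite continuous_subspace_in => /(_ v).
  rewrite inE => /(_ cv) /cvgrPdist_lt /(_ (e / 2)).
  rewrite divr_gt0 // => /(_ isT) hv.
  have : within (@unit_cube R k) (nbhs v) (fun t => `|u v - u t| < e / 2).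
    by rewrite (nbhs_subspace_in cv); exact: hv.
  rewrite /within /=.
  move=> /nbhs_ballP [r /= r0 hr].
  have r20 : 0 < r / 2 by rewrite divr_gt0.
  (* Half of [r] pays for moving from [v] to [v'], the other half for moving from [v'] to [w]. *)
  exists (ball v (r / 2), [set d | d < r / 2]).
    split; first exact: nbhsx_ballx.
    exact: nbhs_right_lt.
  move=> [v' d] /= [bv dr] cv' w cw vw.
  have h1 : `|u v - u v'| < e / 2.
    apply: hr => //; apply: le_ball bv; lra.
  have h2 : `|u v - u w| < e / 2.
    apply: hr => //; split=> // i j; rewrite /ball/=.
    have := bv.2 i j; rewrite /ball /= (ord1 i) => hb.
    have := vw j; have := ler_distD (v' ord0 j) (v ord0 j) (w ord0 j); lra.
  have := ler_distD (u v) (u v') (u w); rewrite [X in _ <= X + _]distrC; lra.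
move=> [r /= r0 hr]; exists (r / 2); first by rewrite divr_gt0.
move=> v w cv cw; apply: (hr (r / 2)) => //=; last by rewrite divr_gt0.
rewrite sub0r normrN ger0_norm; lra.
Qed.

(** * Evaluation of formulas *)

Section Semantics.
Variables (R : realType) (L : signature R).
Implicit Types (M : interp L) (n : nat).

Lemma dist_diff M (preM : is_prestructure M) (x y x' y' : M) :
  `|dist x y - dist x' y'| <= dist x x' + dist y y'.
Proof.
have h := dist_triangle preM; have s := dist_sym preM.
rewrite ler_norml; apply/andP; split.
- have := h x' x y'; have := h x y y'; rewrite (s x' x); lra.
- have := h x x' y; have := h x' y' y; rewrite (s y' y); lra.
Qed.

Lemma eval_term_unif n (t : term L n) (e : R) : 0 < e ->
  exists2 d, 0 < d & forall M, is_prestructure M -> forall e1 e2 : 'I_n -> M,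
    (forall i, dist (e1 i) (e2 i) < d) ->
    dist (eval_term e1 t) (eval_term e2 t) < e.
Proof.
elim: t e => [i|f ts IH] e e0; first by exists e => // M _ e1 e2; exact.
have e20 : 0 < e / 2 by rewrite divr_gt0.
(* The modulus of [f] yields only a non-strict bound, so it is used at [e / 2] to obtain a strict
   one. *)
have [|d d0 hd] := @ord_gt0_bound R (farity f) (fun i d => forall M, is_prestructure M ->
    forall e1 e2 : 'I_n -> M, (forall i, dist (e1 i) (e2 i) < d) ->
    dist (eval_term e1 (ts i)) (eval_term e2 (ts i)) < fmod f (e / 2)).
  move=> i; have [d d0 hd] := IH i _ (fmod_gt0 f e20); exists d => // d' d'd M pM e1 e2 h.
  by apply: hd => // j; apply: lt_le_trans d'd.
exists d => // M pM e1 e2 h /=; apply: (@le_lt_trans _ _ (e / 2)); last by lra.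
by apply: fint_unif => // i; exact: hd.
Qed.

Lemma eval_atom_unif n (a : atom L n) (e : R) : 0 < e ->
  exists2 d, 0 < d & forall M, is_prestructure M -> forall e1 e2 : 'I_n -> M,
    (forall i, dist (e1 i) (e2 i) < d) ->
    `|eval_atom e1 a - eval_atom e2 a| < e.
Proof.
move=> e0; have e20 : 0 < e / 2 by rewrite divr_gt0.
case: a => [t s|P ts].
  have [d d0 hd] := eval_term_unif t e20.
  have [d' d'0 hd'] := eval_term_unif s e20.
  exists (Num.min d d'); first by rewrite lt_min d0.
  move=> M pM e1 e2 h /=; apply: le_lt_trans (dist_diff pM _ _ _ _) _.
  have := hd _ pM e1 e2; have := hd' _ pM e1 e2.
  have hh i := h i; setoid_rewrite lt_min in hh.
  move=> /(_ (fun i => proj2 (andP (hh i)))) ? /(_ (fun i => proj1 (andP (hh i)))); lra.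
have [|d d0 hd] := @ord_gt0_bound R (parity P) (fun i d => forall M, is_prestructure M ->
    forall e1 e2 : 'I_n -> M, (forall i, dist (e1 i) (e2 i) < d) ->
    dist (eval_term e1 (ts i)) (eval_term e2 (ts i)) < pmod P (e / 2)).
  move=> i; have [d d0 hd] := eval_term_unif (ts i) (pmod_gt0 P e20).
  exists d => // d' d'd M pM e1 e2 h.
  by apply: hd => // j; apply: lt_le_trans d'd.
exists d => // M pM e1 e2 h /=; apply: (@le_lt_trans _ _ (e / 2)); last by lra.
by apply: pint_unif => // i; exact: hd.
Qed.

Lemma eval_atom01 M (preM : is_prestructure M) n (a : atom L n) (e : 'I_n -> M) :
  0 <= eval_atom e a <= 1.
Proof.
by case: a => [t s|P ts] /=; rewrite ?dist_ge0 ?dist_le1 ?pint_ge0 ?pint_le1.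
Qed.

Section Eval01.
Variables (M : interp L) (preM : is_prestructure M).

Lemma eval01 n (phi : formula L n) (e : 'I_n -> M) : 0 <= eval phi e <= 1.
Proof.
elim: phi e => [{}n a|{}n k u phis IH|{}n psi IH|{}n psi IH] e /=.
- exact: eval_atom01.
- by apply: cfun_01 => i; rewrite mxE.
- have [x0] := nonempty preM.
  have ub : ubound [set eval psi (env_cons a e) | a in [set: M]] 1.
    by move=> _ [x _ <-]; case/andP: (IH (env_cons x e)).
  have ne : [set eval psi (env_cons a e) | a in [set: M]] !=set0.
    by exists (eval psi (env_cons x0 e)); exists x0.
  apply/andP; split; last exact: ge_sup.
  apply: le_trans (_ : eval psi (env_cons x0 e) <= _).
    by case/andP: (IH (env_cons x0 e)).
  by apply: ub_le_sup; [exists 1|exists x0].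
- have [x0] := nonempty preM.
  have lb : lbound [set eval psi (env_cons a e) | a in [set: M]] 0.
    by move=> _ [x _ <-]; case/andP: (IH (env_cons x e)).
  have ne : [set eval psi (env_cons a e) | a in [set: M]] !=set0.
    by exists (eval psi (env_cons x0 e)); exists x0.
  apply/andP; split; first exact: lb_le_inf.
  apply: (@le_trans _ _ (eval psi (env_cons x0 e))); last by case/andP: (IH (env_cons x0 e)).
  by apply: ge_inf; [exists 0|exists x0].
Qed.

Lemma eval_Sup_eq0 n (psi : formula L n.+1) (e : 'I_n -> M) :
  eval (Sup psi) e = 0 <-> forall a, eval psi (env_cons a e) = 0.
Proof.
split=> [h a|h].
  apply/eqP; rewrite eq_le; case/andP: (eval01 psi (env_cons a e)) => -> _.
  rewrite andbT -h /=; apply: ub_le_sup; last by exists a.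
  by exists 1 => _ [x _ <-]; case/andP: (eval01 psi (env_cons x e)).
have [x0] := nonempty preM.
apply/eqP; rewrite eq_le; case/andP: (eval01 (Sup psi) e) => -> _.
rewrite andbT /=; apply: ge_sup; first by exists (eval psi (env_cons x0 e)); exists x0.
by move=> _ [x _ <-]; rewrite h.
Qed.

Lemma eval_Inf_lt n (psi : formula L n.+1) (e : 'I_n -> M) (r : R) :
  eval (Inf psi) e < r <-> exists a, eval psi (env_cons a e) < r.
Proof.
have [x0] := nonempty preM.
have hi : has_inf [set eval psi (env_cons a e) | a in [set: M]].
  split; first by exists (eval psi (env_cons x0 e)); exists x0.
  by exists 0 => _ [x _ <-]; case/andP: (eval01 psi (env_cons x e)).
split=> [h|[a h]].
  have [_ [x _ <-]] := inf_lt hi.1 h.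
  by exists x.
by apply: le_lt_trans h; apply: ge_inf; [exact: hi.2|exists a].
Qed.

Lemma env_consE (m : nat) (e : 'I_m.+1 -> M) :
  env_cons (e ord0) (fun i => e (lift ord0 i)) = e.
Proof.
by apply: funext => i; rewrite /env_cons; case: unliftP => [j ->|->].
Qed.

(** Each quantifier binds [x_0] and shifts the other variables, so a block of [m] quantified
    variables comes first and [e] occupies the last [n] coordinates. *)
Definition extends_env (m n : nat) (e' : 'I_(m + n) -> M) (e : 'I_n -> M) :=
  forall i, e' (rshift m i) = e i.

Lemma extends_env0 n (e' e : 'I_n -> M) : @extends_env 0 n e' e <-> e' = e.
Proof.
split=> [h|-> i].
  by apply: funext => i; rewrite -h; congr e'; exact: val_inj.
by congr e; exact: val_inj.
Qed.

Lemma extends_env_cons (m n : nat) (a : M) (e' : 'I_(m + n) -> M) (e : 'I_n -> M) :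
  extends_env e' e -> @extends_env m.+1 n (env_cons a e') e.
Proof.
move=> h i; rewrite -h.
have -> : rshift m.+1 i = lift ord0 (rshift m i) by exact: val_inj.
by rewrite /env_cons liftK.
Qed.

Lemma extends_env_tail (m n : nat) (e' : 'I_(m.+1 + n) -> M) (e : 'I_n -> M) :
  extends_env e' e -> @extends_env m n (fun i => e' (lift ord0 i)) e.
Proof. by move=> h i; rewrite -h; congr e'; exact: val_inj. Qed.

Lemma eval_sups_eq0 (m n : nat) (phi : formula L (m + n)) (e : 'I_n -> M) :
  eval (sups phi) e = 0 <->
  forall e' : 'I_(m + n) -> M, extends_env e' e -> eval phi e' = 0.
Proof.
elim: m phi => [|m IH] phi /=.
  split=> [h e' /extends_env0 -> //|]; apply; exact/extends_env0.
rewrite IH; split=> h e' he'.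
  have := h _ (extends_env_tail he').
  by move=> /eval_Sup_eq0 /(_ (e' ord0)); rewrite env_consE.
by apply/eval_Sup_eq0 => a; apply: h; exact: extends_env_cons.
Qed.

Lemma eval_infs_lt (m n : nat) (phi : formula L (m + n)) (e : 'I_n -> M) (r : R) :
  eval (infs phi) e < r <->
  exists2 e' : 'I_(m + n) -> M, extends_env e' e & eval phi e' < r.
Proof.
elim: m phi => [|m IH] phi /=.
  split=> [h|[e' /extends_env0 -> //]]; exists e => //; exact/extends_env0.
rewrite IH; split=> [[e' he'] /eval_Inf_lt [a h]|[e' he' h]].
  by exists (env_cons a e') => //; exact: extends_env_cons.
exists (fun i => e' (lift ord0 i)); first exact: extends_env_tail.
by apply/eval_Inf_lt; exists (e' ord0); rewrite env_consE.
Qed.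

End Eval01.

(** The value is a uniformly continuous function of finitely many atomic values. Two different
    structures are compared so that values can be transferred from a model of [T] to a generic
    structure. *)
Lemma qf_unif n (phi : formula L n) (e : R) : quantifier_free phi -> 0 < e ->
  exists (J : finType) (a : J -> atom L n) (d : R), 0 < d /\
    forall M M', is_prestructure M -> is_prestructure M' ->
    forall (e1 : 'I_n -> M) (e2 : 'I_n -> M'),
    (forall j, `|eval_atom e1 (a j) - eval_atom e2 (a j)| < d) ->
    `|eval phi e1 - eval phi e2| < e.
Proof.
elim: phi e => [{}n a|{}n k u phis IH|{}n psi IH|{}n psi IH] e //= qf e0.
  by exists unit, (fun=> a), e; split=> // M M' _ _ e1 e2 /(_ tt).
have [d d0 hd] := connective_unif u e0.
have /choice [J hJ] : forall i, exists J : finType, exists (a : J -> atom L n),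
    exists2 b : R, 0 < b &
    forall M M', is_prestructure M -> is_prestructure M' ->
    forall (e1 : 'I_n -> M) (e2 : 'I_n -> M'),
    (forall j, `|eval_atom e1 (a j) - eval_atom e2 (a j)| < b) ->
    `|eval (phis i) e1 - eval (phis i) e2| < d.
  by move=> i; have [J [a [b [b0 hb]]]] := IH i d (qf i) d0; exists J, a, b.
pose a i := sval (cid (hJ i)); have ha i := svalP (cid (hJ i)).
have [|c c0 hc] := @ord_gt0_bound R k (fun i c => forall M M', is_prestructure M ->
    is_prestructure M' -> forall (e1 : 'I_n -> M) (e2 : 'I_n -> M'),
    (forall j, `|eval_atom e1 (a i j) - eval_atom e2 (a i j)| < c) ->
    `|eval (phis i) e1 - eval (phis i) e2| < d).
  move=> i; have [c c0 hc] := ha i; exists c => // c' c'c M M' pM pM' e1 e2 h.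
  exact: (hc M M' pM pM' e1 e2 (fun j => lt_le_trans (h j) c'c)).
(* The atoms needed for the subformulas [phis i] are pooled in the disjoint union of their index
   types. *)
exists {i : 'I_k & J i}, (fun ij => a (tag ij) (tagged ij)), c; split=> // M M' pM pM' e1 e2 h.
apply: hd => [i|i|i]; rewrite !mxE; try exact: eval01.
by apply: hc => // j; exact: (h (Tagged J j)).
Qed.

End Semantics.

(** * Completion of a prestructure *)

Lemma inv_small (R : realType) (e : R) : 0 < e ->
  exists N, forall k, (N <= k)%N -> k.+1%:R^-1 < e.
Proof.
move=> e0; exists (Num.truncn e^-1) => k hk.
rewrite invf_plt ?posrE ?ltr0n //.
apply: lt_le_trans (truncnS_gt _) _; by rewrite ler_nat.
Qed.

(* The completion is realized, as in the Kuratowski embedding, by the distance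
   functions [a |-> d(a, x)] to its points [x]. *)
Record katetov (R : realType) (L : signature R) (A : interp L) := Katetov {
  kfun :> A -> R;
  kfun_lip : forall a b, `|kfun b - dist a b| <= kfun a;
  kfun_inf : forall e, 0 < e -> exists a, kfun a < e }.

Section Completion.
Variables (R : realType) (L : signature R) (A : interp L).
Hypothesis preA : is_prestructure A.
Local Notation K := (katetov A).
Implicit Types (f g h : K).

(** For distance functions to points [x] and [y], the sum [d(a,x) + d(a,y)] is at least [d(x,y)] and
    comes arbitrarily close to it as [a] approaches [x]. *)
Definition kdist (f g : K) : R := inf [set f a + g a | a in [set: A]].

Lemma kfun_ge0 f a : 0 <= f a.
Proof. by apply: le_trans (kfun_lip f a a). Qed.

Lemma dist_kfun f a b : dist a b <= f a + f b.
Proof. by have := kfun_lip f a b; rewrite ler_norml => /andP[]; lra. Qed.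

Lemma kdist_lb f g : has_lbound [set f a + g a | a in [set: A]].
Proof. by exists 0 => _ [a _ <-]; rewrite addr_ge0 ?kfun_ge0. Qed.

Lemma kdist_le f g a : kdist f g <= f a + g a.
Proof. by apply: ge_inf (kdist_lb f g) _ _; exists a. Qed.

(** Where [f a] is small, [a] is almost the point [f], so [g a] is almost the distance from [f] to
    [g]. *)
Lemma kdistP f g a : `|kdist f g - g a| <= f a.
Proof.
rewrite ler_norml; apply/andP; split; last by have := kdist_le f g a; lra.
rewrite lerBrDr; apply: lb_le_inf; first by exists (f a + g a); exists a.
move=> _ [b _ <-].
have := kfun_lip g b a; have := kfun_lip f a b; have := dist_sym preA a b.
by rewrite !ler_norml => ? /andP[? ?] /andP[]; lra.
Qed.

Lemma katetov_eq f g : (forall a, f a = g a) -> f = g.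
Proof.
case: f => f f1 f2; case: g => g g1 g2 /= /funext fg; subst g.
by congr Katetov; exact: Prop_irrelevance.
Qed.

Fact kat_of_lip (a b c : A) : `|dist a c - dist b c| <= dist a b.
Proof.
apply: le_trans (dist_diff preA _ _ _ _) _; by rewrite (distxx preA) addr0.
Qed.

Fact kat_of_inf (a : A) (e : R) : 0 < e -> exists b, dist a b < e.
Proof. by exists a; rewrite (distxx preA). Qed.

Definition kat_of (a : A) : K :=
  Katetov (fun b c => kat_of_lip a b c) (@kat_of_inf a).

Lemma kdist_kat_of a f : kdist (kat_of a) f = f a.
Proof.
apply/eqP; rewrite -subr_eq0 -normr_le0.
by apply: le_trans (kdistP _ _ a) _; rewrite /= (distxx preA).
Qed.

Lemma kdistC f g : kdist f g = kdist g f.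
Proof. by congr inf; congr image; apply: funext => a; rewrite addrC. Qed.

Lemma kdist_ge0 f g : 0 <= kdist f g.
Proof.
have [a] := nonempty preA; apply: lb_le_inf; first by exists (f a + g a); exists a.
by move=> _ [b _ <-]; rewrite addr_ge0 ?kfun_ge0.
Qed.

Lemma kdist_le1 f g : kdist f g <= 1.
Proof.
apply: le_eps => e e0; have e20 : 0 < e / 2 by rewrite divr_gt0.
have [a ha] := kfun_inf f e20; have [b hb] := kfun_inf g e20.
have := kdist_le f g a; have := kfun_lip g b a; rewrite ler_norml => /andP[_].
have := dist_le1 preA b a; lra.
Qed.

Lemma kdistxx f : kdist f f = 0.
Proof.
apply/eqP; rewrite eq_le kdist_ge0 andbT; apply: le_eps => e e0.
have e20 : 0 < e / 2 by rewrite divr_gt0.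
by have [a ha] := kfun_inf f e20; have := kdist_le f f a; lra.
Qed.

Lemma kdist_triangle f g h : kdist f h <= kdist f g + kdist g h.
Proof.
apply: le_eps => e e0; have e20 : 0 < e / 2 by rewrite divr_gt0.
have [a ha] := kfun_inf f e20.
have := kdist_le f h a; have := kdistP f g a; have := kdistP h g a.
rewrite (kdistC h g).
have := kdistP g h a.
rewrite !ler_norml => /andP[? ?] /andP[? ?] /andP[? ?]; lra.
Qed.

Lemma kdist_eq0 f g : kdist f g = 0 -> f = g.
Proof.
move=> fg; apply: katetov_eq => a.
have := kdistP f g a; have := kdistP g f a.
by rewrite (kdistC g f) fg !ler_norml => /andP[? ?] /andP[? ?]; lra.
Qed.

Lemma kdist_sup f g a : `|f a - g a| <= kdist f g.
Proof.
have := kdistP f g a; have := kdistP g f a; rewrite (kdistC g f).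
rewrite !ler_norml => /andP[? ?] /andP[? ?]; apply/andP; split; lra.
Qed.

Lemma kdist_complete (u : nat -> K) :
  (forall e : R, 0 < e -> exists N : nat, forall m n : nat,
       (N <= m)%N -> (N <= n)%N -> kdist (u m) (u n) < e) ->
  exists l : K, forall e : R, 0 < e -> exists N : nat, forall n : nat,
       (N <= n)%N -> kdist (u n) l < e.
Proof.
move=> cu.
(* Since [kdist] dominates the sup distance, the pointwise limit is uniform and inherits both
   defining conditions of [katetov]. *)
have /choice [l hl] : forall a, exists x, forall e : R, 0 < e -> exists N, forall n,
    (N <= n)%N -> `|u n a - x| < e.
  move=> a; apply: real_cauchy => e e0; have [N hN] := cu e e0.
  by exists N => m n Nm Nn; apply: le_lt_trans (kdist_sup _ _ _) _; exact: hN.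
have ul (e : R) : 0 < e -> exists N, forall n, (N <= n)%N -> forall a, `|u n a - l a| <= e.
  move=> e0; have [N hN] := cu e e0; exists N => n Nn a; apply: le_eps => d d0.
  have [N' hN'] := hl a d d0.
  have := hN' (maxn N N') (leq_maxr _ _).
  have := le_lt_trans (kdist_sup _ _ a) (hN n (maxn N N') Nn (leq_maxl _ _)).
  by have := ler_distD (u (maxn N N') a) (u n a) (l a); lra.
have lip a b : `|l b - dist a b| <= l a.
  apply: le_eps => e e0; have e20 : 0 < e / 2 by rewrite divr_gt0.
  have [N hN] := ul _ e20; have := hN N (leqnn _) a; have := hN N (leqnn _) b.
  have := kfun_lip (u N) a b.
  by rewrite !ler_norml => /andP[? ?] /andP[? ?] /andP[? ?]; apply/andP; split; lra.
have linf (e : R) : 0 < e -> exists a, l a < e.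
  move=> e0; have e20 : 0 < e / 2 by rewrite divr_gt0.
  have [N hN] := ul _ e20; have [a ha] := kfun_inf (u N) e20; exists a.
  by have := hN N (leqnn _) a; rewrite !ler_norml => /andP[? ?]; lra.
exists (Katetov lip linf) => e e0; have e40 : 0 < e / 4 by rewrite divr_gt0.
have [N hN] := ul _ e40; exists N => n Nn.
have [a ha] := kfun_inf (u n) e40.
have := kdist_le (u n) (Katetov lip linf) a; have := hN n Nn a.
rewrite ler_norml => /andP[? ?] /=; lra.
Qed.

(** A uniformly continuous map into a complete space extends to the completion; [x i (a i) < m] says
    that [a i] is within [m] of the point [x i]. The target is abstract so as to serve both function
    symbols ([K]) and predicate symbols ([R]). *)
Lemma extend_unif (n : nat) (x : 'I_n -> K) (X : Type) (d : X -> X -> R)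
    (F : ('I_n -> A) -> X) :
  (forall p q r, d p r <= d p q + d q r) ->
  (forall u : nat -> X, (forall e : R, 0 < e -> exists N : nat, forall m k : nat,
       (N <= m)%N -> (N <= k)%N -> d (u m) (u k) < e) ->
     exists l, forall e : R, 0 < e -> exists N : nat, forall k : nat,
       (N <= k)%N -> d (u k) l < e) ->
  (forall e : R, 0 < e -> exists2 m, 0 < m & forall a b,
     (forall i, dist (a i) (b i) < m) -> d (F a) (F b) <= e) ->
  exists y, forall e : R, 0 < e -> exists2 m, 0 < m & forall a,
    (forall i, x i (a i) < m) -> d (F a) y <= e.
Proof.
move=> tri cpl uF.
have /choice [s hs] : forall k, exists a : 'I_n -> A, forall i, x i (a i) < k.+1%:R^-1.
  move=> k; have /choice [a ha] : forall i, exists a, x i a < k.+1%:R^-1.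
    by move=> i; apply: kfun_inf; rewrite invr_gt0.
  by exists a.
have [|y hy] := cpl (F \o s).
  move=> e e0; have e20 : 0 < e / 2 by rewrite divr_gt0.
  have [m m0 hm] := uF _ e20; have m20 : 0 < m / 2 by rewrite divr_gt0.
  have [N hN] := inv_small m20; exists N => j k Nj Nk.
  apply: le_lt_trans (hm _ _ _) _ => [i|]; last by lra.
  have := dist_kfun (x i) (s j i) (s k i).
  by have := lt_trans (hs j i) (hN _ Nj); have := lt_trans (hs k i) (hN _ Nk); lra.
exists y => e e0; have e20 : 0 < e / 2 by rewrite divr_gt0.
have [m m0 hm] := uF _ e20; have m20 : 0 < m / 2 by rewrite divr_gt0.
exists (m / 2) => // a ha.
have [N hN] := inv_small m20; have [N' hN'] := hy _ e20.
have := hN' _ (leq_maxr N N'); have := hN _ (leq_maxl N N').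
set k := maxn N N' => h1 h2.
apply: le_trans (tri _ (F (s k)) _) _.
have : d (F a) (F (s k)) <= e / 2.
  apply: hm => i; have := dist_kfun (x i) (a i) (s k i); have := ha i.
  by have := lt_trans (hs k i) h1; lra.
rewrite /= in h2; lra.
Qed.

Lemma kfint_ex (f : fsym L) (x : 'I_(farity f) -> K) : exists y : K,
  forall e : R, 0 < e -> exists2 m, 0 < m & forall a,
    (forall i, x i (a i) < m) -> y (fint f a) <= e.
Proof.
have [|||y hy] := @extend_unif _ x K kdist (fun a => kat_of (fint f a)).
- by move=> p q r; exact: kdist_triangle.
- exact: kdist_complete.
- move=> e e0; exists (fmod f e); first exact: fmod_gt0.
  by move=> a b ab; rewrite kdist_kat_of /= (dist_sym preA); exact: fint_unif.
by exists y => e /hy [m m0 hm]; exists m => // a /hm; rewrite kdist_kat_of.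
Qed.

Lemma kpint_ex (P : psym L) (x : 'I_(parity P) -> K) : exists y : R,
  forall e : R, 0 < e -> exists2 m, 0 < m & forall a,
    (forall i, x i (a i) < m) -> `|pint P a - y| <= e.
Proof.
apply: (@extend_unif _ x R (fun r s => `|r - s|) (pint P)).
- by move=> p q r; exact: ler_distD.
- exact: real_cauchy.
- move=> e e0; exists (pmod P e); first exact: pmod_gt0.
  by move=> a b ab; exact: pint_unif.
Qed.

Definition completion_interp : interp L :=
  @Interp R L K kdist (fun F x => sval (cid (@kfint_ex F x)))
    (fun P x => sval (cid (@kpint_ex P x))).

(** Moduli of continuity require a strict inequality in [A]; the gap between [kdist (x i) (y i)] and
    [m] leaves room for approximating both tuples. *)
Lemma katetov_close (n : nat) (x y : 'I_n -> K) (d d' m : R) :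
  0 < d -> 0 < d' -> (forall i, kdist (x i) (y i) < m) ->
  exists a b, [/\ forall i, x i (a i) < d, forall i, y i (b i) < d' &
    forall i, dist (a i) (b i) < m].
Proof.
move=> d0 d'0 xy; have [|r r0 hr] := @ord_gt0_bound R n (fun i r => kdist (x i) (y i) + 2 * r < m).
  move=> i; exists ((m - kdist (x i) (y i)) / 4).
    by rewrite divr_gt0 // subr_gt0.
  by move=> e; have := xy i; lra.
have /choice [a ha] : forall i, exists a, x i a < Num.min d r.
  by move=> i; apply: kfun_inf; rewrite lt_min d0.
have /choice [b hb] : forall i, exists a, y i a < Num.min d' r.
  by move=> i; apply: kfun_inf; rewrite lt_min d'0.
exists a, b; split=> i; have := ha i; have := hb i; rewrite !lt_min => /andP[? ?] /andP[? ?] //.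
have := hr i; have := kdist_sup (x i) (y i) (b i); have := dist_kfun (x i) (a i) (b i).
by rewrite ler_norml => ? /andP[? ?] ?; lra.
Qed.

Lemma completion_pre : is_prestructure completion_interp.
Proof.
split=> /=.
- by have [a] := nonempty preA; constructor; exact: kat_of.
- exact: kdist_ge0.
- exact: kdist_le1.
- exact: kdistxx.
- exact: kdistC.
- exact: kdist_triangle.
- move=> f x y e e0 xy; case: cid => /= u hu; case: cid => /= v hv.
  apply: le_eps => d d0; have d20 : 0 < d / 2 by rewrite divr_gt0.
  have [m m0 hm] := hu _ d20; have [m' m'0 hm'] := hv _ d20.
  have [a [b [xa yb ab]]] := katetov_close m0 m'0 xy.
  have := hm a xa.
  have := hm' b yb.
  have := fint_unif preA e0 ab.
  have := kdist_triangle u (kat_of (fint f a)) v.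
  have := kfun_lip v (fint f b) (fint f a).
  rewrite [kdist u (kat_of _)]kdistC !kdist_kat_of (dist_sym preA (fint f b)) ler_norml.
  by move=> /andP[? ?]; lra.
- move=> P x; case: cid => /= u hu; apply: le_eps => d d0.
  have [m m0 hm] := hu _ d0.
  have /choice [a ha] : forall i, exists a, x i a < m by move=> i; exact: kfun_inf.
  by have := hm a ha; have := pint_ge0 preA a; rewrite ler_norml => ? /andP[? ?]; lra.
- move=> P x; case: cid => /= u hu; apply: le_eps => d d0.
  have [m m0 hm] := hu _ d0.
  have /choice [a ha] : forall i, exists a, x i a < m by move=> i; exact: kfun_inf.
  by have := hm a ha; have := pint_le1 preA a; rewrite ler_norml => ? /andP[? ?]; lra.
- move=> P x y e e0 xy; case: cid => /= u hu; case: cid => /= v hv.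
  apply: le_eps => d d0; have d20 : 0 < d / 2 by rewrite divr_gt0.
  have [m m0 hm] := hu _ d20; have [m' m'0 hm'] := hv _ d20.
  have [a [b [xa yb ab]]] := katetov_close m0 m'0 xy.
  have := hm a xa.
  have := hm' b yb.
  have := pint_unif preA e0 ab.
  by rewrite !ler_norml => /andP[? ?] /andP[? ?] /andP[? ?]; apply/andP; split; lra.
Qed.

Definition completion : structure L :=
  @Structure R L completion_interp completion_pre kdist_eq0 kdist_complete.

Lemma completionP : is_completion A completion.
Proof.
exists kat_of; split; last first.
  move=> y e e0; have [a ha] := kfun_inf y e0.
  by exists a; rewrite /= kdist_kat_of.
split=> [x y|f x|P x] /=.
- by rewrite kdist_kat_of /= (dist_sym preA).
- apply: kdist_eq0; rewrite kdist_kat_of; case: cid => /= u hu.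
  apply/eqP; rewrite eq_le kfun_ge0 andbT; apply: le_eps => e e0.
  rewrite add0r; have [m m0 hm] := hu _ e0; apply: hm => i.
  by rewrite (distxx preA).
- case: cid => /= u hu; apply/eqP; rewrite -subr_eq0 -normr_le0; apply: le_eps => e e0.
  rewrite add0r distrC; have [m m0 hm] := hu _ e0; apply: hm => i.
  by rewrite (distxx preA).
Qed.

End Completion.

(** * New constants *)

Lemma finite_enum (T : Type) (A : set T) : finite_set A ->
  exists n (f : 'I_n -> T), (forall i, A (f i)) /\ forall x, A x -> exists i, x = f i.
Proof.
move=> /(@finite_seqP {classic T}) [s ->].
exists (size s), (tnth (in_tuple s)); split=> [i|x] /=.
  exact: (@mem_tnth _ {classic T} i (in_tuple s)).
move=> /(@tnthP _ _ (in_tuple s)) [i ->].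
by exists i.
Qed.

Section Constants.
Variables (R : realType) (L : signature R).
Local Notation LC := (add_const L).

(** From here on an [L(C)]-structure is handled as an [L]-structure with a naming [g] of its
    constants, because the arguments compare several namings of one structure. *)
Definition expand_interp (M : interp L) (g : nat -> M) : interp LC :=
  @Interp R LC M dist
    (fun f => match f return ('I_(@farity R LC f) -> M) -> M with
              | inl f => @fint R L M f
              | inr n => fun=> g n
              end)
    (@pint R L M).

Lemma expand_pre (M : interp L) (g : nat -> M) :
  is_prestructure M -> is_prestructure (expand_interp g).
Proof.
move=> preM; case: (preM) => *; split=> //.
by move=> [f|n] x y e e0 xy /=; [exact: fint_unif|rewrite (distxx preM) ltW].
Qed.

Definition expand (M : structure L) (g : nat -> M) : structure LC :=
  @Structure R LC (expand_interp g) (@expand_pre M g (struct_pre M))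
    (@struct_sep R L M) (@struct_complete R L M).

Lemma reduct_expand (M : interp L) (g : nat -> M) :
  reduct_interp (expand_interp g) = M.
Proof. by case: M g. Qed.

Definition consts (N : interp LC) (n : nat) : N :=
  @fint R LC N (inr n) (@empty_env N).

Lemma expand_reduct (N : interp LC) :
  expand_interp (consts N : nat -> reduct_interp N) = N.
Proof.
case: N => N d F P; rewrite /expand_interp /=; congr Interp.
apply: functional_extensionality_dep => -[f|n] //=; apply: funext => x.
by rewrite /consts /=; congr (F _ _); apply: funext => -[].
Qed.

Definition cterm (M : interp L) (g : nat -> M) (t : term LC 0) : M :=
  @eval_term R LC (expand_interp g) 0 (@empty_env M) t.
Definition catom (M : interp L) (g : nat -> M) (a : atom LC 0) : R :=
  @eval_atom R LC (expand_interp g) 0 (@empty_env M) a.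
Definition cform (M : interp L) (g : nat -> M) (phi : rformula LC 0) : R :=
  @eval_r R LC (expand_interp g) 0 (@empty_env M) phi.

Lemma cform_consts (N : interp LC) phi :
  cform (consts N : nat -> reduct_interp N) phi = eval_r (@empty_env N) phi.
Proof. exact: (congr1 (fun X : interp LC => eval_r (@empty_env X) phi) (expand_reduct N)). Qed.

Lemma catom_consts (N : interp LC) a :
  catom (consts N : nat -> reduct_interp N) a = eval_atom (@empty_env N) a.
Proof. exact: (congr1 (fun X : interp LC => eval_atom (@empty_env X) a) (expand_reduct N)). Qed.

(** * Renaming, substitution and support of the new constants *)

Fixpoint ren_term (h : nat -> nat) (t : term LC 0) : term LC 0 :=
  match t with
  | Var i => Var i
  | App f ts =>
    match f return ('I_(@farity R LC f) -> term LC 0) -> term LC 0 with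
    | inl f => fun ts => @App R LC 0 (inl f) ts
    | inr n => fun ts => @App R LC 0 (inr (h n)) ts
    end (fun i => ren_term h (ts i))
  end.

Definition ren_atom (h : nat -> nat) (a : atom LC 0) : atom LC 0 :=
  match a with
  | Dist t s => Dist (ren_term h t) (ren_term h s)
  | Pred P ts => @Pred R LC 0 P (fun i => ren_term h (ts i))
  end.

Fixpoint ren_form (h : nat -> nat) (phi : rformula LC 0) : rformula LC 0 :=
  match phi with
  | RAtom a => RAtom (ren_atom h a)
  | RHalf phi => RHalf (ren_form h phi)
  | RNeg phi => RNeg (ren_form h phi)
  | RPlus phi psi => RPlus (ren_form h phi) (ren_form h psi)
  end.

Lemma cterm_ren (M : interp L) (g : nat -> M) h t :
  cterm g (ren_term h t) = cterm (g \o h) t.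
Proof.
elim: t => [i //|[f|n] ts IH] //=; rewrite /cterm /=.
by congr fint; apply: funext => i; exact: IH.
Qed.

Lemma catom_ren (M : interp L) (g : nat -> M) h a :
  catom g (ren_atom h a) = catom (g \o h) a.
Proof.
case: a => [t s|P ts]; rewrite /catom /=.
  by have := cterm_ren g h t; have := cterm_ren g h s; rewrite /cterm => -> ->.
by congr pint; apply: funext => i; exact: cterm_ren.
Qed.

Lemma cform_ren (M : interp L) (g : nat -> M) h phi :
  cform g (ren_form h phi) = cform (g \o h) phi.
Proof.
rewrite /cform; elim: phi => [a|phi IH|phi IH|phi IH psi IH'] /=.
- exact: catom_ren.
- by rewrite IH.
- by rewrite IH.
- by rewrite IH IH'.
Qed.

Definition new_const (n : nat) : term LC 0 := @App R LC 0 (inr n) (@empty_env _).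

Fixpoint sub_term (n : nat) (s : 'I_n -> nat) (t : term L n) : term LC 0 :=
  match t with
  | Var i => new_const (s i)
  | App f ts => @App R LC 0 (inl f) (fun i => sub_term s (ts i))
  end.

Definition sub_atom (n : nat) (s : 'I_n -> nat) (a : atom L n) : atom LC 0 :=
  match a with
  | Dist t t' => Dist (sub_term s t) (sub_term s t')
  | Pred P ts => @Pred R LC 0 P (fun i => sub_term s (ts i))
  end.

Lemma cterm_sub (M : interp L) (g : nat -> M) n (s : 'I_n -> nat) t :
  cterm g (sub_term s t) = eval_term (fun i => g (s i)) t.
Proof.
rewrite /cterm; elim: t => [i //|f ts IH] //=.
by congr fint; apply: funext => i; exact: IH.
Qed.

Lemma catom_sub (M : interp L) (g : nat -> M) n (s : 'I_n -> nat) a :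
  catom g (sub_atom s a) = eval_atom (fun i => g (s i)) a.
Proof.
case: a => [t t'|P ts]; rewrite /catom /=.
  by have := cterm_sub g s t; have := cterm_sub g s t'; rewrite /cterm => -> ->.
by congr pint; apply: funext => i; exact: cterm_sub.
Qed.

(** A term mentions finitely many constants. Hence a naming may be altered at large indices without
    affecting a given finite condition, which provides fresh constants. *)
Lemma cterm_support t : exists K, forall (M : interp L) (g g' : nat -> M),
  (forall i, (i < K)%N -> g i = g' i) -> cterm g t = cterm g' t.
Proof.
elim: t => [i|[f|n] ts IH]; first by exists 0%N.
- have /choice [k hk] := IH; exists (\max_i k i)%N => M g g' gg'.
  rewrite /cterm /=; congr fint; apply: funext => i; apply: hk => j ji.
  by apply: gg'; apply: leq_trans ji _; exact: leq_bigmax.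
- by exists n.+1 => M g g' gg'; rewrite /cterm /= gg'.
Qed.

Lemma catom_support a : exists K, forall (M : interp L) (g g' : nat -> M),
  (forall i, (i < K)%N -> g i = g' i) -> catom g a = catom g' a.
Proof.
case: a => [t s|P ts].
  have [k hk] := cterm_support t; have [k' hk'] := cterm_support s.
  exists (maxn k k') => M g g' gg'; congr dist.
    by apply: hk => i ik; apply: gg'; rewrite leq_max ik.
  by apply: hk' => i ik; apply: gg'; rewrite leq_max ik orbT.
have /choice [k hk] := fun i => cterm_support (ts i); exists (\max_i k i)%N => M g g' gg'.
rewrite /catom /=; congr pint; apply: funext => i; apply: hk => j ji.
by apply: gg'; apply: leq_trans ji _; exact: leq_bigmax.
Qed.

Lemma cform_support phi : exists K, forall (M : interp L) (g g' : nat -> M),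
  (forall i, (i < K)%N -> g i = g' i) -> cform g phi = cform g' phi.
Proof.
rewrite /cform; elim: phi => [a|phi [k hk]|phi [k hk]|phi [k hk] psi [k' hk']] /=.
- exact: catom_support.
- by exists k => M g g' /hk ->.
- by exists k => M g g' /hk ->.
- exists (maxn k k') => M g g' gg'; rewrite (hk M g g') ?(hk' M g g') // => i ik; apply: gg'.
  + by rewrite leq_max ik orbT.
  + by rewrite leq_max ik.
Qed.

Section Embedding.
Variables (A B : interp L) (h : A -> B) (emb : embedding h) (g : nat -> A).

Lemma cterm_emb t : h (cterm g t) = cterm (h \o g) t.
Proof.
have [_ hf _] := emb; rewrite /cterm; elim: t => [[]//|[f|n] ts IH] //=.
by rewrite hf; congr fint; apply: funext => i; exact: IH.
Qed.

Lemma catom_emb a : catom (h \o g) a = catom g a.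
Proof.
have [hd _ hp] := emb; case: a => [t s|P ts]; rewrite /catom /=.
  by have := cterm_emb t; have := cterm_emb s; rewrite /cterm => <- <-; exact: hd.
rewrite -hp; congr pint; apply: funext => i; symmetry; exact: cterm_emb.
Qed.

Lemma cform_emb phi : cform (h \o g) phi = cform g phi.
Proof.
rewrite /cform; elim: phi => [a|phi IH|phi IH|phi IH psi IH'] /=.
- exact: catom_emb.
- by rewrite IH.
- by rewrite IH.
- by rewrite IH IH'.
Qed.
End Embedding.

(** * Satisfaction of sets of expressions by a naming *)

Definition sat (p : set (expr L)) (M : interp L) (g : nat -> M) : Prop :=
  forall phi r, p (phi, r) -> cform g phi < r.

Lemma sat_sub p q (M : interp L) (g : nat -> M) : p `<=` q -> sat q g -> sat p g.
Proof. by move=> pq hq phi r /pq /hq. Qed.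

Lemma satU p q (M : interp L) (g : nat -> M) : sat (p `|` q) g <-> sat p g /\ sat q g.
Proof.
split=> [h|[hp hq] phi r [/hp|/hq]] //.
by split=> phi r h'; apply: h; [left|right].
Qed.

Lemma sat_support p : finite_set p -> exists K, forall (M : interp L) (g g' : nat -> M),
  (forall i, (i < K)%N -> g i = g' i) -> sat p g -> sat p g'.
Proof.
move=> /finite_enum [n [f [_ hf]]].
have /choice [k hk] := fun i => cform_support (f i).1.
exists (\max_i k i)%N => M g g' gg' hp phi r pr.
have [i fi] := hf _ pr; have := hp _ _ pr; have := hk i M g g'; rewrite -fi /= => -> // j jk.
by apply: gg'; apply: leq_trans jk _; exact: leq_bigmax.
Qed.

Lemma sat_emb (A B : interp L) (h : A -> B) (g : nat -> A) p :
  embedding h -> sat p (h \o g) <-> sat p g.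
Proof. by move=> emb; split=> hp phi r /hp; rewrite (cform_emb emb). Qed.

Definition ren_set (h : nat -> nat) (p : set (expr L)) : set (expr L) :=
  [set (ren_form h e.1, e.2) | e in p].

Lemma sat_ren h p (M : interp L) (g : nat -> M) :
  sat (ren_set h p) g <-> sat p (g \o h).
Proof.
split=> hp phi r; last by move=> [[psi s] ps [<- <-]] /=; rewrite cform_ren; exact: hp.
by move=> pr; rewrite -cform_ren; apply: hp; exists (phi, r).
Qed.

Definition close_set (h h' : nat -> nat) (n : nat) (e : R) : set (expr L) :=
  [set (RAtom (Dist (new_const (h x)) (new_const (h' x))), e) | x in `I_n].

Lemma sat_close h h' n e (M : interp L) (g : nat -> M) :
  sat (close_set h h' n e) g <-> forall x, (x < n)%N -> dist (g (h x)) (g (h' x)) < e.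
Proof.
split=> [hp x xn|hx phi r [x xn [<- <-]]]; last exact: hx.
have : cform g (RAtom (Dist (new_const (h x)) (new_const (h' x)))) < e by apply: hp; exists x.
by [].
Qed.

(** Rational bounds keep the lists of expressions countable, so that requirements about them can be
    met one after another in a play. *)
Definition qexpr : Type := (rformula LC 0 * rat)%type.

Definition satq (Q : seq qexpr) (M : interp L) (g : nat -> M) : bool :=
  all (fun e => cform g e.1 < ratr e.2) Q.

Fixpoint exprs (Q : seq qexpr) : set (expr L) :=
  if Q is e :: Q' then (e.1, ratr e.2) |` exprs Q' else set0.

Lemma exprs_finite Q : finite_set (exprs Q).
Proof.
elim: Q => [|e Q IH] /=; first exact: finite_set0.
by rewrite finite_setU; split=> //; exact: finite_set1.
Qed.

Lemma sat_exprs Q (M : interp L) (g : nat -> M) : sat (exprs Q) g <-> satq Q g.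
Proof.
elim: Q => [|[psi q] Q IH] /=; first by split=> // _ phi r [].
rewrite satU IH; split=> [[h ->]|/andP[h ?]]; first by rewrite andbT; exact: h.
by split=> // phi r [-> ->].
Qed.

(** Terms, atoms and restricted formulas are coded as finite trees labelled by natural numbers. *)
Lemma countable_rformula : countable_signature L ->
  exists c : rformula LC 0 -> nat, injective c.
Proof.
move=> [/countable_injP [cF injF] /countable_injP [cP injP]].
have {}injF : injective cF by move=> x y; apply: injF; rewrite inE.
have {}injP : injective cP by move=> x y; apply: injP; rewrite inE.
pose c (f : fsym LC) : nat :=
  pickle (match f with inl f => inl (cF f) | inr n => inr n end : nat + nat).
have injc : injective c.
  move=> f f' /(pcan_inj (@pickleK _)).
  by case: f f' => [f|n] [f'|n'] //= [] => [/injF ->|->].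
pose fix ct (t : term LC 0) : GenTree.tree nat := match t with
  | Var i => GenTree.Leaf 0%N
  | App f ts => GenTree.Node (c f) [seq ct (ts i) | i <- enum 'I_(farity f)] end.
have injt : injective ct.
  elim=> [[//]|f ts IH] [[//]|f' ts'] /= [/injc ff'].
  (* Identifying the head symbols first aligns the arities, so that the lists of codes can be
     compared argument by argument. *)
  case: _ / ff' ts' => ts' /eq_in_map tt; congr App; apply: funext => i.
  by apply: IH; apply: tt; rewrite mem_enum.
pose ca (a : atom LC 0) : GenTree.tree nat := match a with
  | Dist t s => GenTree.Node 0%N [:: ct t; ct s]
  | Pred P ts => GenTree.Node (cP P).+1 [seq ct (ts i) | i <- enum 'I_(@parity R LC P)] end.
have inja : injective ca.
  move=> [t s|P ts] [t' s'|P' ts'] //=; first by move=> [/injt -> /injt ->].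
  move=> [/injP PP']; case: _ / PP' ts' => ts' /eq_in_map tt; congr Pred; apply: funext => i.
  by apply: injt; apply: tt; rewrite mem_enum.
pose fix cr (phi : rformula LC 0) : GenTree.tree nat := match phi with
  | RAtom a => GenTree.Node 0%N [:: ca a]
  | RHalf phi => GenTree.Node 1%N [:: cr phi]
  | RNeg phi => GenTree.Node 2%N [:: cr phi]
  | RPlus phi psi => GenTree.Node 3%N [:: cr phi; cr psi] end.
have injr : injective cr.
  elim=> [a|phi IH|phi IH|phi IH psi IH'] [a'|phi'|phi'|phi' psi'] //= [].
  - by move=> /inja ->.
  - by move=> /IH ->.
  - by move=> /IH ->.
  - by move=> /IH -> /IH' ->.
by exists (pickle \o cr) => x y /(pcan_inj (@pickleK _)) /injr.
Qed.

End Constants.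

(** * Conditions and genericity *)

Section Conditions.
Variables (R : realType) (L : signature R) (T : set (sentence L)).
Local Notation LC := (add_const L).

Lemma models_with_expand p (M : structure L) (g : nat -> M) :
  models_with T p (expand g) <-> models T M /\ sat p g.
Proof.
rewrite /models_with -[models T (reduct _)]/(models T (reduct_interp (expand_interp g))).
by rewrite reduct_expand; split=> -[h1 h2]; split.
Qed.

Lemma models_withE p (N : structure LC) :
  models_with T p N <-> models T (reduct N) /\ sat p (consts N : nat -> reduct N).
Proof.
split=> -[MT h]; split=> // phi r /h; rewrite (cform_consts N) //.
Qed.

Lemma conditionP p : condition T p <-> finite_set p /\
  exists (M : structure L) (g : nat -> M), models T M /\ sat p g.
Proof.
split=> -[fp]; last first.
  by move=> [M [g h]]; split=> //; exists (expand g); exact/models_with_expand.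
by move=> [N /models_withE h]; split=> //; exists (reduct N), (consts N).
Qed.

Lemma condition_extend p q (M : structure L) (g : nat -> M) :
  finite_set p -> finite_set q -> models T M -> sat p g -> sat q g ->
  condition T (p `|` q).
Proof.
move=> fp fq MT hp hq; apply/conditionP; split; first by rewrite finite_setU.
by exists M, g; split=> //; apply/satU.
Qed.

(** Density in the forcing order, where larger sets are stronger: from any position a player can
    move into [D]. *)
Definition dense_below (D : set (set (expr L))) : Prop :=
  forall p, condition T p -> exists q, [/\ condition T q, p `<=` q & D q].

Definition decides (a : atom LC 0) (k : nat) (q : set (expr L)) : Prop :=
  exists c : R, forall (M : interp L) (g : nat -> M),
    sat q g -> `|catom g a - c| < k.+1%:R^-1.

Lemma dense_decides a k : dense_below (decides a k).
Proof.
move=> p /conditionP [fp [M [g [MT hp]]]].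
have k0 : 0 < k.+1%:R^-1 :> R by rewrite invr_gt0.
rewrite /decides; move: k.+1%:R^-1 k0 => d d0; pose c := catom g a.
(* Conditions contain only upper bounds; the lower bound [c - d] on the atom is an upper bound on
   its negation. *)
pose q : set (expr L) := [set (RAtom a, c + d); (RNeg (RAtom a), 1 - c + d)].
exists (p `|` q); split; last 1 first.
- exists c => N f /satU [_ hq].
  have h1 := hq (RAtom a) _ (or_introl erefl); have h2 := hq (RNeg (RAtom a)) _ (or_intror erefl).
  rewrite /cform /= -/(catom f a) in h1 h2.
  by rewrite ltr_norml; apply/andP; split; lra.
- apply: (condition_extend (M := M) (g := g)) => //.
    by rewrite finite_setU; split; exact: finite_set1.
  by move=> phi r [[-> ->]|[-> ->]]; rewrite /cform /= -/(catom g a) /c; lra.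
- by move=> x; left.
Qed.

(** A Henkin property for the existential statement [Q], with the constants below [N] as parameters
    and the others quantified: either [q] already names witnesses through [h], or no model of [T]
    and [q] contains any. *)
Definition decides_ext (N : nat) (Q : seq (qexpr L)) (q : set (expr L)) : Prop :=
  (exists h : nat -> nat, (forall i, (i < N)%N -> h i = i) /\
     forall (M : interp L) (g : nat -> M), sat q g -> satq Q (g \o h)) \/
  ~ (exists (M : structure L) (g g' : nat -> M),
     [/\ models T M, sat q g, satq Q g' & forall i, (i < N)%N -> g i = g' i]).

Lemma dense_decides_ext N Q : dense_below (decides_ext N Q).
Proof.
move=> p cp; have [fp _] := cp.
case: (EM (exists (M : structure L) (g g' : nat -> M),
     [/\ models T M, sat p g, satq Q g' & forall i, (i < N)%N -> g i = g' i])); last first.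
  by move=> h; exists p; split=> //; right.
move=> [M [g [g' [MT hp hQ gg']]]].
have [K hK] := sat_support fp.
(* The witnesses are moved beyond both [N] and the support of [p], where [f] can interpret them by
   [g'] without disturbing [p]. *)
pose h i := if (i < N)%N then i else (maxn K N + i)%N.
pose f i := if (i < maxn K N)%N then g i else g' (i - maxn K N)%N.
have fh : f \o h = g'.
  apply: funext => i /=; rewrite /f /h; case: (ltnP i N) => iN.
    by rewrite (leq_trans iN (leq_maxr _ _)) gg'.
  by rewrite ltnNge leq_addr /= addKn.
exists (p `|` ren_set h (exprs Q)); split; last 1 first.
- left; exists h; split; first by move=> i iN; rewrite /h iN.
  by move=> M' k /satU [_ /sat_ren /sat_exprs].
- apply: (condition_extend (M := M) (g := f)) => //.
  + exact/finite_image/exprs_finite.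
  + by apply: hK hp => i iK; rewrite /f (leq_trans iK (leq_maxl _ _)).
  + by apply/sat_ren; rewrite fh; apply/sat_exprs.
- by move=> x; left.
Qed.

(** Turns requirements indexed by a countable type into a sequence; a number that codes nothing
    imposes a vacuous requirement. *)
Lemma dense_enum (I : Type) (c : I -> nat) (D : I -> set (set (expr L))) :
  injective c -> (forall i, dense_below (D i)) ->
  forall k, dense_below (fun q => forall i, c i = k -> D i q).
Proof.
move=> injc dD k p cp; case: (EM (exists i, c i = k)) => [[i ik]|h].
  have [q [cq pq Dq]] := dD i p cp; exists q; split=> // j jk.
  by have -> : j = i by apply: injc; rewrite jk.
by exists p; split=> // i ik; case: h; exists i.
Qed.

(** Strict inequalities are not preserved by limits. Replacing each bound by a strictly smaller one
    at a later stage preserves the original inequality in the limit. *)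
Definition shrinks (p q : set (expr L)) : Prop :=
  forall phi r, p (phi, r) -> exists2 s, s < r & q (phi, s).

Lemma dense_shrinks D : dense_below D -> forall p, condition T p ->
  exists q, [/\ condition T q, p `<=` q, D q & shrinks p q].
Proof.
move=> dD p /conditionP [fp [M [g [MT hp]]]].
(* The new bound is the midpoint between the value in a model of [p] and the old bound. *)
pose q : set (expr L) := [set (e.1, (cform g e.1 + e.2) / 2) | e in p].
have cpq : condition T (p `|` q).
  apply: (condition_extend (M := M) (g := g)) => //; first exact: finite_image.
  by move=> phi r [[psi s] ps [<- <-]] /=; have := hp _ _ ps; lra.
have [q' [cq' pq' Dq']] := dD _ cpq; exists q'; split=> //.
  by move=> e pe; apply: pq'; left.
move=> phi r pr; exists ((cform g phi + r) / 2); first by have := hp _ _ pr; lra.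
by apply: pq'; right; exists (phi, r).
Qed.

Definition chain (p : nat -> set (expr L)) : Prop :=
  (forall n, condition T (p n)) /\ forall n, p n `<=` p n.+1.

Lemma chain_le p : chain p -> forall m n, (m <= n)%N -> p m `<=` p n.
Proof.
move=> [_ pS] m n /subnK <-; elim: (n - m)%N => // k IH.
by apply: subset_trans IH _; exact: pS.
Qed.

Lemma chain_model p n : chain p -> exists (M : structure L) (g : nat -> M),
  models T M /\ sat (p n) g.
Proof. by move=> [cp _]; have /conditionP [] := cp n. Qed.

Definition ext_generic (p : nat -> set (expr L)) : Prop :=
  forall N Q, exists n, decides_ext N Q (p n).

(** * Chains meeting the extension requirements *)

Section ExtGeneric.
Variables (p : nat -> set (expr L)).
Hypotheses (cp : chain p) (ep : ext_generic p).
Variables (M : structure L) (g : nat -> M).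
Hypothesis gp : forall n, sat (p n) g.

(** Take a constant [N] beyond those of the term [t] and consider the requirement that it be close
    to [t]. It cannot be refuted, because [N] may be reinterpreted as the value of [t]; so some
    constant is close to [t]. *)
Lemma ext_generic_dense :
  (forall (y : M) (e : R), 0 < e -> exists t, dist (cterm g t) y < e) ->
  forall (y : M) (e : R), 0 < e -> exists i, dist (g i) y < e.
Proof.
move=> hd y e e0; have e20 : 0 < e / 2 by rewrite divr_gt0.
have [t ht] := hd y _ e20; have [N hN] := cterm_support t.
have [q] := rat_in_itvoo e20; rewrite in_itv /= => /andP[q0 qe].
pose Q : seq (qexpr L) := [:: (RAtom (Dist t (new_const L N)), q)].
have [n [[h [hi hh]]|[]]] := ep N Q.
  have := hh M g (@gp n); rewrite /= andbT.
  rewrite /cform /= -/(cterm (g \o h) t) => hQ.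
  have E : cterm g t = cterm (g \o h) t.
    by apply: hN => i iN; rewrite /= hi.
  exists (h N); rewrite -E in hQ.
  have := dist_triangle (struct_pre M) (g (h N)) (cterm g t) y.
  have := dist_sym (struct_pre M) (g (h N)) (cterm g t); lra.
have [D [f [DT fp]]] := chain_model n cp.
pose f' i := if i == N then cterm f t else f i.
have ff' i : (i < N)%N -> f i = f' i by rewrite /f'; case: ltngtP.
exists D, f, f'; split=> //; rewrite /= andbT.
by rewrite /cform /= -/(cterm f' t) -(hN D f f') // /f' eqxx (distxx (struct_pre D)).
Qed.


(** A witness in a model of [T] is described by its atomic values up to a grid, which is an
    expression list [Q b]. Extension genericity realizes the same grid cell by constants, and
    [qf_unif] transfers the value of [phi]. *)
Lemma ext_generic_approx (m k : nat) (phi : formula L (k + m)) (s : 'I_m -> nat) (e : R) :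
  quantifier_free phi -> 0 < e ->
  (forall D : structure L, models T D -> forall x : 'I_m -> D,
     exists2 y : 'I_(k + m) -> D, extends_env y x & eval phi y < e) ->
  exists2 z : 'I_(k + m) -> M, extends_env z (g \o s) & eval phi z < 2 * e.
Proof.
move=> qf e0 hT.
have [J [a [d [d0 hd]]]] := qf_unif qf e0.
have d20 : 0 < d / 2 by rewrite divr_gt0.
have [K /(_ K (leqnn _)) hK] := inv_small d20.
pose N := (\max_i s i).+1.
have sN i : (s i < N)%N by rewrite ltnS; exact: leq_bigmax.
(* Parameters become the constants [s x], all below [N]; witnesses become the constants from [N]
   on. *)
pose t (i : 'I_(k + m)) : nat := match fintype.split i with inl z => (N + z)%N | inr x => s x end.
have tl z : t (lshift m z) = (N + z)%N by rewrite /t (unsplitK (inl z)).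
have tr x : t (rshift k x) = s x by rewrite /t (unsplitK (inr x)).
(* [Q b] places the [j]-th atomic value strictly between [(b j - 1)/(K+1)] and [(b j + 1)/(K+1)].
   The index goes up to [K+1] in order to cover the value 1. *)
pose lo (i : 'I_K.+2) : rat := 1 - (i%:R - 1) / K.+1%:R.
pose up (i : 'I_K.+2) : rat := i.+1%:R / K.+1%:R.
pose Q (b : {ffun J -> 'I_K.+2}) : seq (qexpr L) :=
  [seq (RAtom (sub_atom t (a j)), up (b j)) | j <- enum J] ++
  [seq (RNeg (RAtom (sub_atom t (a j))), lo (b j)) | j <- enum J].
have QP (b : {ffun J -> 'I_K.+2}) (A : interp L) (f : nat -> A) : satq (Q b) f <->
    forall j, ((b j)%:R - 1 < K.+1%:R * eval_atom (f \o t) (a j) < (b j).+1%:R).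
  have P1 (i : 'I_K.+2) (x : R) : (x < ratr (up i)) = (K.+1%:R * x < i.+1%:R).
    by rewrite /up fmorph_div /= !ratr_nat ltr_pdivlMr ?ltr0n // mulrC.
  have P2 (i : 'I_K.+2) (x : R) : (1 - x < ratr (lo i)) = (i%:R - 1 < K.+1%:R * x).
    rewrite /lo rmorphB fmorph_div rmorphB rmorph1 /= !ratr_nat ltrD2l ltrN2.
    by rewrite ltr_pdivrMr ?ltr0n // mulrC.
  rewrite /satq all_cat; split.
    move=> /andP[/all_enum h1 /all_enum h2] j.
    have := h1 j; have := h2 j; rewrite /= /cform /= -/(catom f _) !catom_sub P1 P2.
    by move=> -> ->.
  move=> h; apply/andP; split; apply/all_enum => j; have /andP[h1 h2] := h j;
    by rewrite /cform /= -/(catom f _) catom_sub ?P1 ?P2.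
(* There are finitely many [b], so a single condition of the chain settles all the [Q b]; a witness
   in a model of it then selects the relevant [b]. *)
have /choice [n hn] := fun b => ep N (Q b).
have [D [f [DT fp]]] := chain_model (\max_b n b)%N cp.
have [y yx hy] := hT D DT (f \o s).
pose f' i := if (i < N)%N then f i else
  if insub (i - N)%N is Some z then y (lshift m z) else f i.
have f't i : f' (t i) = y i.
  case: (split_ordP i) => [z ->|x ->].
    by rewrite tl /f' ltnNge leq_addr /= addKn valK.
  by rewrite tr /f' sN yx.
have a01 j := eval_atom01 (struct_pre D) (a j) y.
have /choice [b0 hb0] : forall j, exists i : 'I_K.+2,
    i%:R - 1 < K.+1%:R * eval_atom y (a j) < i.+1%:R.
  move=> j; have /andP[x0 x1] := a01 j; move: (eval_atom y (a j)) x0 x1 => x x0 x1.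
  have kx : 0 <= K.+1%:R * x by rewrite mulr_ge0.
  have kK : (Num.truncn (K.+1%:R * x) < K.+2)%N.
    rewrite ltnS -(ler_nat R); apply: le_trans (_ : K.+1%:R * x <= _).
      by rewrite truncn_le.
    by rewrite -[X in _ <= X]mulr1 ler_pM2l ?ltr0n.
  exists (Ordinal kK) => /=; rewrite truncnS_gt andbT.
  have : (Num.truncn (K.+1%:R * x))%:R <= K.+1%:R * x by rewrite truncn_le.
  lra.
pose b := [ffun j => b0 j].
have fQ : satq (Q b) f'.
  apply/QP => j; rewrite ffunE.
  by have -> : f' \o t = y by apply: funext.
have nb : p (n b) `<=` p (\max_b n b)%N by apply: chain_le => //; exact: leq_bigmax.
case: (hn b) => [[h [hi hh]]|[]]; last first.
  exists D, f, f'; split=> //; first exact: sat_sub fp.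
  by move=> i iN; rewrite /f' iN.
have /QP gQ := hh _ _ (@gp (n b)).
exists (g \o h \o t); first by move=> x /=; rewrite tr hi.
suff : `|eval phi (g \o h \o t) - eval phi y| < e.
  by rewrite ltr_norml => /andP[_]; lra.
apply: hd => //; try exact: struct_pre.
move=> j; have := gQ j; have := hb0 j; rewrite ffunE.
move=> /andP[l1 l2] /andP[l3 l4].
rewrite -(ltr_pM2l (ltr0Sn R K)) -[K.+1%:R in X in X < _]ger0_norm ?ler0n // -normrM.
have : 2 < K.+1%:R * d by move: hK; rewrite invf_plt ?posrE // invf_div ltr_pdivrMr //.
by rewrite -natr1 in l2 l4; rewrite ltr_norml mulrBr => ?; apply/andP; split; lra.
Qed.

(** Arbitrary parameters are approximated by constants, for which approximate witnesses exist;
    uniform continuity allows the parameters to be put back while the witnesses are kept. *)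
Lemma ext_generic_models : forall_exists_axiomatizable T ->
  (forall (y : M) (e : R), 0 < e -> exists i, dist (g i) y < e) -> models T M.
Proof.
move=> [T' [T'ae hT']] dense_g; apply/hT' => sigma T's.
have [m [k [phi [qf sE]]]] := T'ae _ T's.
rewrite sE; apply/(eval_sups_eq0 (struct_pre M)) => e _.
apply/eqP; rewrite eq_le; case/andP: (eval01 (struct_pre M) (infs phi) e) => -> _.
rewrite andbT; apply: le_eps => r r0; rewrite add0r.
have r30 : 0 < r / 3 by rewrite divr_gt0.
apply/ltW/(eval_infs_lt (struct_pre M)).
have [J [a [d [d0 hd]]]] := qf_unif qf r30.
have [|c c0 hc] := @ord_gt0_bound R #|J| (fun j c => forall (e1 e2 : 'I_(k + (m + 0)) -> M),
  (forall i, dist (e1 i) (e2 i) < c) ->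
  `|eval_atom e1 (a (enum_val j)) - eval_atom e2 (a (enum_val j))| < d).
  move=> j; have [c c0 hc] := eval_atom_unif (a (enum_val j)) d0.
  exists c => // c' c'c e1 e2 h; apply: hc => [|i]; first exact: struct_pre.
  exact: lt_le_trans c'c.
have /choice [s hs] : forall i, exists n, dist (g n) (e i) < c.
  by move=> i; exact: dense_g.
have [|z zx hz] := @ext_generic_approx _ _ phi s (r / 3) qf r30.
  move=> D /hT' /(_ _ T's); rewrite sE => /(eval_sups_eq0 (struct_pre D)) h x.
  apply/(eval_infs_lt (struct_pre D)); rewrite h //.
  by move=> [].
pose z' (i : 'I_(k + (m + 0))) := match fintype.split i with inl j => z i | inr x => e x end.
exists z'; first by move=> x; rewrite /z' (unsplitK (inr x)).
suff : `|eval phi z - eval phi z'| < r / 3 by rewrite ltr_norml => /andP[]; lra.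
apply: hd => [||j]; try exact: struct_pre.
rewrite -(enum_rankK j); apply: hc => i.
rewrite /z'; case: (split_ordP i) => [l ->|x ->].
  by rewrite (distxx (struct_pre M)).
by rewrite zx; exact: hs.
Qed.

End ExtGeneric.
End Conditions.

(** * Compiled structures *)

Section Compiled.
Variables (R : realType) (L : signature R) (T : set (sentence L)).
Local Notation LC := (add_const L).

(** [term_interp T P] is the case where [v] is [atom_value T P]; a general [v] allows the values to
    be defined as limits. *)
Definition term_model (v : atom LC 0 -> R) : interp LC :=
  @Interp R LC (term LC 0) (fun t s => v (Dist t s)) App (fun P ts => v (Pred P ts)).

Lemma eval_term_model v (N : interp LC) (h : term_model v -> N) t :
  embedding h -> eval_term (@empty_env N) t = h t.
Proof.
move=> [_ hf _]; elim: t => [[]//|f ts IH] /=.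
by rewrite (hf f ts); congr fint; apply: funext => i; exact: IH.
Qed.

Lemma eval_atom_model v (N : interp LC) (h : term_model v -> N) a :
  embedding h -> eval_atom (@empty_env N) a = v a.
Proof.
move=> emb; have [hd _ hp] := emb; case: a => [t s|P ts] /=.
  by rewrite !(eval_term_model _ emb) hd.
rewrite -[RHS](hp P ts); congr pint; apply: funext => i; exact: eval_term_model.
Qed.

Lemma cterm_consts (N : interp LC) t :
  cterm (consts N : nat -> reduct_interp N) t = eval_term (@empty_env N) t.
Proof.
rewrite /cterm; elim: t => [[]//|[f|n] ts IH] /=; last by congr fint; apply: funext => -[].
by congr fint; apply: funext => i; exact: IH.
Qed.

Lemma cform_catom (M N : interp L) (f : nat -> M) (g : nat -> N) :
  (forall a, catom f a = catom g a) -> forall phi, cform f phi = cform g phi.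
Proof.
move=> h; rewrite /cform; elim=> [a|phi IH|phi IH|phi IH psi IH'] /=.
- exact: h.
- by rewrite IH.
- by rewrite IH.
- by rewrite IH IH'.
Qed.

Lemma definitive_model P : definitive T P ->
  exists (M : structure L) (g : nat -> M),
    [/\ models T M, sat P g & forall a, catom g a = atom_value T P a].
Proof.
move=> defP.
have [N NP] : exists N : structure LC, models_with T P N.
  (* Without a model every value is entailed, so 0 and 1 would both be the unique value of one
     atom. *)
  apply: contrapT => none.
  have [r [_ runiq]] := defP (Dist (new_const L 0%N) (new_const L 0%N)).
  have h0 : r = 0 by apply: runiq; split=> [|N NP]; [rewrite lexx ler01|case: none; exists N].
  have h1 : r = 1 by apply: runiq; split=> [|N NP]; [rewrite lexx ler01|case: none; exists N].
  by move/eqP: h1; rewrite h0 eq_sym oner_eq0.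
have /models_withE [NT hs] := NP; exists (reduct N), (consts N); split=> // a.
rewrite (catom_consts N) /atom_value.
have [r [hr _]] := defP a.
by case: xgetP => [s _ [_ /(_ N NP)]|/(_ r)].
Qed.

(** A model of the definitive set [P] and the compiled structure have the same atomic values, so the
    inequalities in [P] carry over. This serves plays of an arbitrary winning strategy. *)
Lemma compiled_consts P (M : structure LC) :
  definitive T P -> is_completion (term_interp T P) M ->
  [/\ sat P (consts M : nat -> reduct M) &
  forall (y : reduct M) (e : R), 0 < e ->
    exists t, dist (cterm (consts M : nat -> reduct M) t) y < e].
Proof.
move=> defP [h [emb hd]]; split; last first.
  move=> y e e0; have [t ht] := hd y e e0; exists t.
  by rewrite (cterm_consts M) (@eval_term_model (atom_value T P) M h).
have [N [f [_ hs fv]]] := definitive_model defP.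
move=> phi r /hs; congr (_ < _); apply: cform_catom => a.
by rewrite fv (catom_consts M) (@eval_atom_model (atom_value T P) M h).
Qed.

Variable p : nat -> set (expr L).
Hypothesis cp : chain T p.
Hypothesis dp : forall a k, exists n, decides a k (p n).

Lemma decides_close (M N : interp L) (g : nat -> M) (f : nat -> N) a :
  (forall n, sat (p n) g) -> (forall n, sat (p n) f) -> catom g a = catom f a.
Proof.
move=> hg hf; apply/eqP; rewrite -subr_eq0 -normr_le0; apply: le_eps => e e0.
have e20 : 0 < e / 2 by rewrite divr_gt0.
have [k /(_ k (leqnn _)) hk] := inv_small e20; have [n [c hc]] := dp a k.
have := lt_trans (hc M g (hg n)) hk; have := lt_trans (hc N f (hf n)) hk.
by rewrite !ltr_norml ler_norml => /andP[? ?] /andP[? ?]; apply/andP; split; lra.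
Qed.

Lemma decided_compiled (M : structure L) (g : nat -> M) :
  models T M -> (forall n, sat (p n) g) ->
  (forall (y : M) (e : R), 0 < e -> exists t, dist (cterm g t) y < e) ->
  let P := \bigcup_n p n in
  definitive T P /\ is_completion (term_interp T P) (expand g).
Proof.
move=> MT gp dense_g P.
have satP (N : interp L) (f : nat -> N) : sat P f <-> forall n, sat (p n) f.
  split=> [h n phi r pr|h phi r [n _ pr]]; last exact: h pr.
  by apply: h; exists n.
have gP : models_with T P (expand g) by apply/models_with_expand; split=> //; exact/satP.
have ent a : entails_eq T P a (catom g a).
  move=> N /models_withE [NT /satP hN]; rewrite -(catom_consts N).
  by apply: decides_close.
have defP : definitive T P.
  move=> a; exists (catom g a); split; last by move=> r [_ /(_ _ gP)].
  by split=> //; apply: eval_atom01; exact: expand_pre (struct_pre M).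
split=> //; have vE a : atom_value T P a = catom g a.
  rewrite /atom_value; have [r [hr _]] := defP a.
  by case: xgetP => [s _ [_ /(_ _ gP)]|/(_ r)].
exists (cterm g : term_interp T P -> expand g); split; last exact: dense_g.
split=> [t s|f ts|Q ts] /=.
- by rewrite vE.
- by case: f ts.
- by rewrite vE.
Qed.

Hypothesis op : forall n phi r, p n (phi, r) -> exists m s, s < r /\ p m (phi, s).
Hypothesis ep : ext_generic T p.
Hypothesis aeT : forall_exists_axiomatizable T.

(** The term algebra receives as atomic values the limits of those in models of the [p n]: [dp]
    makes them converge, [op] keeps the strict inequalities, and [ep] makes the completion a model
    of [T]. *)
Lemma canonical_model : exists (M : structure L) (g : nat -> M),
  [/\ models T M, forall n, sat (p n) g &
      forall (y : M) (e : R), 0 < e -> exists t, dist (cterm g t) y < e].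
Proof.
have /choice [A hA] : forall n, exists A : {M : structure L & nat -> M},
    models T (tag A) /\ sat (p n) (tagged A).
  by move=> n; have [M [g h]] := chain_model n cp; exists (existT _ M g).
pose f n := tagged (A n).
have fp m n : (m <= n)%N -> sat (p m) (f n).
  by move=> mn; apply: sat_sub (hA n).2; exact: chain_le cp _ _ mn.
have preA n : is_prestructure (expand_interp (f n)) by exact: expand_pre (struct_pre _).
have /choice [v hv] : forall a, exists v, forall e : R, 0 < e -> exists N, forall n,
    (N <= n)%N -> `|catom (f n) a - v| < e.
  move=> a; apply: real_cauchy => e e0; have e20 : 0 < e / 2 by rewrite divr_gt0.
  have [k /(_ k (leqnn _)) hk] := inv_small e20; have [n [c hc]] := dp a k.
  exists n => i j ni nj.
  have := lt_trans (hc _ _ (fp _ _ ni)) hk; have := lt_trans (hc _ _ (fp _ _ nj)) hk.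
  by rewrite !ltr_norml => /andP[? ?] /andP[? ?]; apply/andP; split; lra.
(* Apart from non-emptiness, each axiom concerns finitely many atomic values and passes to the
   limit. *)
have preX : is_prestructure (term_model v).
  split=> /=.
  - exact: (inhabits (new_const L 0%N)).
  - move=> x y; apply: le_eps => e e0; have [N /(_ N (leqnn _))] := hv (Dist x y) e e0.
    have := dist_ge0 (preA N) (cterm (f N) x) (cterm (f N) y); rewrite /catom /=.
    by rewrite ltr_norml => ? /andP[? ?]; lra.
  - move=> x y; apply: le_eps => e e0; have [N /(_ N (leqnn _))] := hv (Dist x y) e e0.
    have := dist_le1 (preA N) (cterm (f N) x) (cterm (f N) y); rewrite /catom /=.
    by rewrite ltr_norml => ? /andP[? ?]; lra.
  - move=> x; apply/eqP; rewrite -normr_le0; apply: le_eps => e e0.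
    have [N /(_ N (leqnn _))] := hv (Dist x x) e e0; rewrite /catom /=.
    by rewrite (distxx (struct_pre (tag (A N)))) sub0r normrN; lra.
  - move=> x y; apply/eqP; rewrite -subr_eq0 -normr_le0; apply: le_eps => e e0.
    have e20 : 0 < e / 2 by rewrite divr_gt0.
    have [N hN] := hv (Dist x y) _ e20; have [N' hN'] := hv (Dist y x) _ e20.
    have := hN _ (leq_maxl N N'); have := hN' _ (leq_maxr N N'); rewrite /catom /=.
    rewrite (dist_sym (struct_pre (tag (A (maxn N N'))))) !ltr_norml ler_norml.
    by move=> /andP[? ?] /andP[? ?]; apply/andP; split; lra.
  - move=> x y z; apply: le_eps => e e0; have e30 : 0 < e / 3 by rewrite divr_gt0.
    have [|N /(_ N (leqnn _)) hN] := @ord_bound 3 (fun i n =>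
      let a := nth (Dist x y) [:: Dist x y; Dist y z; Dist x z] i in
      `|catom (f n) a - v a| < e / 3).
      by move=> i; exact: hv.
    have := hN (inord 0); have := hN (inord 1); have := hN (inord 2); rewrite !inordK //=.
    have := dist_triangle (preA N) (cterm (f N) x) (cterm (f N) y) (cterm (f N) z).
    rewrite /catom /= !ltr_norml /cterm => ? /andP[? ?] /andP[? ?] /andP[? ?]; lra.
  - move=> F x y e e0 xy; apply: le_eps => d d0.
    (* The limit distances are strictly below the modulus, so the distances in [f n] are too for all
       large [n], and the axiom can be applied there. *)
    have [|N hN] := @ord_bound (@farity R LC F) (fun i n =>
        catom (f n) (Dist (x i) (y i)) < @fmod R LC F e).
      move=> i; have [|N hN] := hv (Dist (x i) (y i)) (@fmod R LC F e - v (Dist (x i) (y i))).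
        by rewrite subr_gt0.
      exists N => k Nk; have := hN k Nk; rewrite ltr_norml; lra.
    have [N' hN'] := hv (Dist (@App R LC 0 F x) (@App R LC 0 F y)) _ d0.
    have := hN' _ (leq_maxr N N'); have := hN _ (leq_maxl N N').
    move: (maxn N N') => n hn.
    have := fint_unif (preA n) e0 hn.
    by rewrite {1}/catom /= ltr_norml => ? /andP[? ?]; lra.
  - move=> P x; apply: le_eps => e e0; have [N /(_ N (leqnn _))] := hv (@Pred _ LC 0 P x) e e0.
    have := pint_ge0 (preA N) (fun i => cterm (f N) (x i)); rewrite /catom /=.
    by rewrite ltr_norml => ? /andP[? ?]; lra.
  - move=> P x; apply: le_eps => e e0; have [N /(_ N (leqnn _))] := hv (@Pred _ LC 0 P x) e e0.
    have := pint_le1 (preA N) (fun i => cterm (f N) (x i)); rewrite /catom /=.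
    by rewrite ltr_norml => ? /andP[? ?]; lra.
  - move=> P x y e e0 xy; apply: le_eps => d d0; have d20 : 0 < d / 2 by rewrite divr_gt0.
    have [|N hN] := @ord_bound (@parity R LC P) (fun i n =>
        catom (f n) (Dist (x i) (y i)) < pmod P e).
      move=> i; have [|N hN] := hv (Dist (x i) (y i)) (pmod P e - v (Dist (x i) (y i))).
        by rewrite subr_gt0; exact: xy.
      exists N => k Nk; have := hN k Nk; rewrite ltr_norml; lra.
    have [N1 hN1] := hv (@Pred _ LC 0 P x) _ d20.
    have [N2 hN2] := hv (@Pred _ LC 0 P y) _ d20.
    pose n := maxn N (maxn N1 N2).
    have := hN1 n; have := hN2 n; have := hN n; rewrite !leq_max !leqnn !orbT.
    move=> /(_ isT) hn /(_ isT) h2 /(_ isT) h1; move: h1 h2.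
    have := pint_unif (preA n) e0 hn.
    rewrite /catom /= /cterm !ltr_norml !ler_norml.
    by move=> /andP[? ?] /andP[? ?] /andP[? ?]; apply/andP; split; lra.
have [h [emb hd]] := completionP preX; pose N := completion preX.
pose g : nat -> reduct N := consts N.
have gv a : catom g a = v a by rewrite (catom_consts N) (eval_atom_model _ emb).
have dense_g (y : reduct N) (e : R) : 0 < e -> exists t, dist (cterm g t) y < e.
  move=> e0; have [t ht] := hd y e e0; exists t.
  by rewrite (cterm_consts N) (eval_term_model _ emb).
have lim phi (e : R) : 0 < e -> exists N, forall n, (N <= n)%N ->
    `|cform (f n) phi - cform g phi| < e.
  rewrite /cform; elim: phi e => [a|phi IH|phi IH|phi IH psi IH'] e e0 /=.
  - by have [m hm] := hv a e e0; exists m => n /hm; rewrite -gv.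
  - have [m hm] := IH e e0; exists m => n /hm; apply: le_lt_trans.
    by rewrite -mulrBl normrM ler_piMr // ger0_norm; lra.
  - have [m hm] := IH e e0; exists m => n /hm; rewrite !ltr_norml => /andP[? ?].
    by apply/andP; split; lra.
  - have e20 : 0 < e / 2 by rewrite divr_gt0.
    have [m hm] := IH _ e20; have [m' hm'] := IH' _ e20; exists (maxn m m') => n.
    rewrite geq_max => /andP[/hm + /hm'].
    move: (eval_r _ _) (eval_r _ _) (eval_r _ _) (eval_r _ _) => a b c d.
    rewrite /Num.min !ltr_norml => /andP[? ?] /andP[? ?].
    by case: ifPn; case: ifPn; rewrite -?leNgt => ? ?; apply/andP; split; lra.
(* A limit of values below [r] might equal [r]; [op] supplies a smaller bound [s] imposed by a later
   condition. *)
have gp n : sat (p n) g.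
  move=> phi r /op [m [s [sr ps]]].
  have rs0 : 0 < r - s by rewrite subr_gt0.
  have [k hk] := lim phi _ rs0.
  have := hk _ (leq_maxr m k); have := fp _ _ (leq_maxl m k) _ _ ps.
  by rewrite ltr_norml => ? /andP[? ?]; lra.
exists (reduct N), g; split=> //.
apply: (ext_generic_models cp ep (g := g)) => //.
exact: (ext_generic_dense cp ep (g := g)).
Qed.

End Compiled.

(** * Structures with matching dense sequences *)

Section DenseIso.
Variables (R : realType) (L : signature R).

Section Rel.
Variables (M M' : structure L) (u : nat -> M) (u' : nat -> M').
Hypothesis dense_u : forall (y : M) (e : R), 0 < e -> exists i, dist (u i) y < e.
Hypothesis uu' : forall n (a : atom L n) (x : 'I_n -> nat),
  eval_atom (u \o x) a = eval_atom (u' \o x) a.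

(** The graph of the future isomorphism: a point is identified by its distances to the dense
    sequence. *)
Definition same_dist (y : M) (y' : M') : Prop :=
  forall i, dist y (u i) = dist y' (u' i).

Lemma same_dist_u i : same_dist (u i) (u' i).
Proof.
move=> j; exact: (uu' (Dist (Var (ord0 : 'I_2)) (Var ord_max))
  (fun k => if k == ord0 then i else j)).
Qed.

Lemma same_dist_ex y : exists y', same_dist y y'.
Proof.
have /choice [x hx] : forall k, exists i, dist (u i) y < k.+1%:R^-1.
  by move=> k; apply: dense_u; rewrite invr_gt0.
have pM := struct_pre M; have pM' := struct_pre M'.
have [|y' hy'] := struct_complete (s := M') (u := u' \o x).
  move=> e e0; have e20 : 0 < e / 2 by rewrite divr_gt0.
  have [N hN] := inv_small e20; exists N => m n Nm Nn /=.
  rewrite -same_dist_u.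
  have := lt_trans (hx m) (hN m Nm); have := lt_trans (hx n) (hN n Nn).
  have := dist_triangle pM (u (x m)) y (u (x n)); rewrite (dist_sym pM y); lra.
exists y' => i; apply/eqP; rewrite -subr_eq0 -normr_le0; apply: le_eps => e e0.
have e20 : 0 < e / 2 by rewrite divr_gt0.
have [N hN] := inv_small e20; have [N' hN'] := hy' _ e20.
have := hN' _ (leq_maxr N N'); rewrite /=; have := lt_trans (hx _) (hN _ (leq_maxl N N')).
move: (x (maxn N N')) => n /=; have := same_dist_u n i.
have := dist_diff pM y (u i) (u n) (u i); have := dist_diff pM' y' (u' i) (u' n) (u' i).
rewrite !distxx // !addr0 !ler_norml (dist_sym pM y (u n)) (dist_sym pM' y' (u' n)).
by move=> /andP[? ?] /andP[? ?] ? ? ?; apply/andP; split; lra.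
Qed.

Lemma same_dist_inj y y1 y2 : same_dist y y1 -> same_dist y y2 -> y1 = y2.
Proof.
move=> h1 h2; apply: struct_sep; apply/eqP; rewrite eq_le dist_ge0 ?andbT; last exact: struct_pre.
apply: le_eps => e e0; have e20 : 0 < e / 2 by rewrite divr_gt0.
have [i] := dense_u y e20; have pM := struct_pre M; have pM' := struct_pre M'.
have := dist_triangle pM' y1 (u' i) y2; have := dist_sym pM' (u' i) y2.
by have := h1 i; have := h2 i; have := dist_sym pM y (u i); lra.
Qed.

Lemma same_dist_atom n (a : atom L n) (y : 'I_n -> M) (y' : 'I_n -> M') :
  (forall i, same_dist (y i) (y' i)) -> eval_atom y a = eval_atom y' a.
Proof.
move=> yy'; apply/eqP; rewrite -subr_eq0 -normr_le0; apply: le_eps => e e0.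
have e20 : 0 < e / 2 by rewrite divr_gt0.
have [d d0 hd] := eval_atom_unif a e20.
have /choice [x hx] : forall i, exists j, dist (u j) (y i) < d by move=> i; exact: dense_u.
have := hd _ (struct_pre M) (u \o x) y hx.
have := hd _ (struct_pre M') (u' \o x) y'; rewrite uu'.
rewrite !ltr_norml ler_norml => /(_ _)/andP[|? ?].
  move=> i /=; rewrite (dist_sym (struct_pre M')) -yy' (dist_sym (struct_pre M)); exact: hx.
by move=> /andP[? ?]; apply/andP; split; lra.
Qed.

End Rel.

Lemma dense_isomorphic (M M' : structure L) (u : nat -> M) (u' : nat -> M') :
  (forall (y : M) (e : R), 0 < e -> exists i, dist (u i) y < e) ->
  (forall (y : M') (e : R), 0 < e -> exists i, dist (u' i) y < e) ->
  (forall n (a : atom L n) (x : 'I_n -> nat),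
     eval_atom (u \o x) a = eval_atom (u' \o x) a) ->
  isomorphic M M'.
Proof.
move=> du du' uu'.
have u'u n (a : atom L n) x : eval_atom (u' \o x) a = eval_atom (u \o x) a by rewrite uu'.
have /choice [h hh] := same_dist_ex du uu'.
have /choice [k hk] := same_dist_ex du' u'u.
exists h; split.
  exists k => y.
    by apply: (same_dist_inj du' (hk (h y))) => i; rewrite hh.
  by apply: (same_dist_inj du (hh (k y))) => i; rewrite hk.
split=> [x y|f x|P x].
- symmetry; apply: (same_dist_atom du uu' (Dist (Var (ord0 : 'I_2)) (Var ord_max))
    (y := fun i => if i == ord0 then x else y) (y' := fun i => if i == ord0 then h x else h y)).
  by move=> i; case: ifP => _; exact: hh.
- apply: (same_dist_inj du (hh _)) => i.
  (* The distance from [fint f c] to a member of the dense sequence is an atom in [c] and one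
     further variable, so [same_dist_atom] applies to it. *)
  have E (N : interp L) (b : N) (c : 'I_(farity f) -> N) : dist (fint f c) b =
      eval_atom (env_cons b c) (Dist (App f (fun j => Var (lift ord0 j))) (Var ord0)).
    rewrite /= {2}/env_cons unlift_none; congr dist; congr fint.
    by apply: funext => j; rewrite /env_cons liftK.
  rewrite !E; apply: (same_dist_atom du uu' _) => j; rewrite /env_cons.
  by case: unliftP => [l _|_]; [exact: hh|exact: same_dist_u].
- by symmetry; apply: (same_dist_atom du uu' (Pred P Var)) => j; exact: hh.
Qed.

Definition geo (n : nat) : R := (2 ^ n)%:R^-1.

Lemma geo_gt0 n : 0 < geo n.
Proof. by rewrite invr_gt0 ltr0n expn_gt0. Qed.

Lemma geoS n : geo n.+1 = geo n / 2.
Proof. by rewrite /geo expnS natrM invfM mulrC. Qed.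

Lemma geo_small (e : R) : 0 < e -> exists N, forall n, (N <= n)%N -> geo n < e.
Proof.
move=> /inv_small [N hN]; exists N => n /hN; apply: le_lt_trans.
by rewrite lef_pV2 ?posrE ?ltr0n ?expn_gt0 // ler_nat ltn_expl.
Qed.

(** The bounds [2 * geo k] for [k >= n] sum to [4 * geo n]. *)
Lemma geo_limit (M : structure L) (y : nat -> M) (N : nat) :
  (forall n, (N <= n)%N -> dist (y n) (y n.+1) <= 2 * geo n) ->
  exists l, forall n, (N <= n)%N -> dist (y n) l <= 4 * geo n.
Proof.
move=> hy; have pM := struct_pre M.
have far n k : (N <= n)%N -> dist (y n) (y (n + k)%N) <= 4 * (geo n - geo (n + k)).
  move=> Nn; elim: k => [|k IH]; first by rewrite addn0 (distxx pM) subrr mulr0.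
  have := hy (n + k)%N (leq_trans Nn (leq_addr _ _)); rewrite -addnS => h.
  have := dist_triangle pM (y n) (y (n + k)%N) (y (n + k.+1)%N).
  by move: h; rewrite addnS geoS; lra.
have far' m n : (N <= m)%N -> (m <= n)%N -> dist (y m) (y n) <= 4 * geo m.
  move=> Nm /subnKC <-; apply: le_trans (far _ _ Nm) _; have := geo_gt0 (m + (n - m)); lra.
have [|l hl] := struct_complete (s := M) (u := y).
  move=> e e0; have e40 : 0 < e / 4 by rewrite divr_gt0.
  have [K hK] := geo_small e40; exists (maxn N K) => m n.
  rewrite !geq_max => /andP[Nm Km] /andP[Nn Kn].
  case: (leqP m n) => mn; first by have := far' _ _ Nm mn; have := hK _ Km; lra.
  rewrite (dist_sym pM); have := far' _ _ Nn (ltnW mn); have := hK _ Kn; lra.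
exists l => n Nn; apply: le_eps => e e0; have [K hK] := hl e e0.
have := far' n (maxn n K) Nn (leq_maxl _ _); have := hK _ (leq_maxr n K).
have := dist_triangle pM (y n) (y (maxn n K)) l; lra.
Qed.

End DenseIso.

(** * Isolation and back-and-forth *)

Section BackAndForth.
Variables (R : realType) (L : signature R) (T : set (sentence L)).
Local Notation LC := (add_const L).

(** [f] selects the constants of [r] that play the roles of those of [q]. *)
Definition forces (r : set (expr L)) (f : nat -> nat) (q : set (expr L)) : Prop :=
  forall (M : structure L) (g : nat -> M), models T M -> sat r g -> sat q (g \o f).

Definition compatible (n : nat) (e : R) (r1 : set (expr L)) (f1 : nat -> nat)
    (r2 : set (expr L)) (f2 : nat -> nat) : Prop :=
  exists (M : structure L) (g1 g2 : nat -> M), [/\ models T M, sat r1 g1, sat r2 g2 &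
    forall x, (x < n)%N -> dist (g1 (f1 x)) (g2 (f2 x)) < e].

Definition isolates (n : nat) (e : R) (q : set (expr L)) : Prop :=
  forall r1 f1 r2 f2, condition T r1 -> condition T r2 ->
    forces r1 f1 q -> forces r2 f2 q -> compatible n e r1 f1 r2 f2.

(** Expresses through pairs of finite stages that the tuples named by [s] and [s'] have nearby
    types; no amalgam of the two limit structures is involved. *)
Definition linked (p p' : nat -> set (expr L)) (s s' : nat -> nat) (n : nat) (e : R) : Prop :=
  forall i i', compatible n e (p i) s (p' i') s'.

Lemma linked_sym p p' s s' n e : linked p p' s s' n e -> linked p' p s' s n e.
Proof.
move=> h i i'; have [M [g1 [g2 [MT h1 h2 h12]]]] := h i' i.
exists M, g2, g1; split=> // x xn; rewrite (dist_sym (struct_pre M)); exact: h12.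
Qed.

Lemma linked0 p p' s s' e : JEP T -> chain T p -> chain T p' -> linked p p' s s' 0 e.
Proof.
move=> jep cp cp' i i'.
have [A [f [AT hf]]] := chain_model i cp; have [B [g [BT hg]]] := chain_model i' cp'.
have [D [DT [[h1 e1] [h2 e2]]]] := jep A B AT BT.
by exists D, (h1 \o f), (h2 \o g); split=> //; exact/sat_emb.
Qed.

(* Strict inequalities leave room for rational thresholds between those of [p i]
   and those of a later condition; countability of the requirements needs this. *)
Lemma rational_approx p i : chain T p ->
  (forall n phi r, p n (phi, r) -> exists m s, s < r /\ p m (phi, s)) ->
  exists Q m, (forall (M : interp L) (g : nat -> M), satq Q g -> sat (p i) g) /\
    (forall (M : interp L) (g : nat -> M), sat (p m) g -> satq Q g).
Proof.
move=> cp op; have [n [f [pf fp]]] := finite_enum (cp.1 i).1.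
have /choice [c hc] : forall j, exists c : rat * nat, ratr c.1 < (f j).2 /\
    exists2 s, s < ratr c.1 & p c.2 ((f j).1, s).
  move=> j; have := pf j; case: (f j) => phi r pr.
  have [m [s [sr ps]]] := op _ _ _ pr; have [q] := rat_in_itvoo sr.
  by rewrite in_itv /= => /andP[sq qr]; exists (q, m); split=> //; exists s.
exists [seq ((f j).1, (c j).1) | j <- enum 'I_n], (\max_j (c j).2)%N; split=> M g.
  rewrite /satq all_map => /allP h phi r pr; have [j fj] := fp _ pr.
  have := h j; rewrite mem_enum /= -fj /= => /(_ isT) /lt_trans; apply.
  by have [] := hc j; rewrite -fj.
move=> h; rewrite /satq all_map; apply/allP => j _ /=.
have [_ [s sc ps]] := hc j; apply: lt_trans sc; apply: h.
by apply: chain_le cp _ _ _ _ ps; exact: leq_bigmax.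
Qed.

Lemma compatible_le n e r1 f1 r2 f2 r1' r2' : r1 `<=` r1' -> r2 `<=` r2' ->
  compatible n e r1' f1 r2' f2 -> compatible n e r1 f1 r2 f2.
Proof.
move=> s1 s2 [M [g1 [g2 [MT h1 h2 h]]]]; exists M, g1, g2; split=> //.
  exact: sat_sub h1.
exact: sat_sub h2.
Qed.

(** Some [p i] isolates the tuple extended by the constant [j]. Extension genericity finds a copy of
    [p i] inside [p'] near the old partners, and isolation links the copy with the original, at a
    precision [e2] unrelated to [e]. *)
Lemma forth p p' (M' : structure L) (g' : nat -> M') s s' n (e : R) j (e2 : R) :
  chain T p -> chain T p' ->
  (forall n phi r, p n (phi, r) -> exists m s, s < r /\ p m (phi, s)) ->
  (forall n k, exists m, isolates n k.+1%:R^-1 (p m)) ->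
  ext_generic T p' -> (forall n, sat (p' n) g') ->
  0 < e -> 0 < e2 -> linked p p' s s' n e ->
  exists t', linked p p' (fun x => if x == n then j else s x) t' n.+1 e2 /\
    forall x, (x < n)%N -> dist (g' (t' x)) (g' (s' x)) < 2 * e.
Proof.
move=> cp cp' op ap ep' gp' e0 e20 lk; pose t x := if x == n then j else s x.
have [k /(_ k (leqnn _)) hk] := inv_small e20.
(* [m] exceeds every constant of the tuple, so isolating the first [m] constants controls the whole
   tuple. *)
pose m := (\max_(x < n.+1) t x).+1.
have tm x : (x < n.+1)%N -> (t x < m)%N.
  by move=> xn; rewrite ltnS; apply: (leq_bigmax (F := fun x : 'I_n.+1 => t x) (Ordinal xn)).
have [i hi] := ap m k.
have [Q [l [Qp pQ]]] := rational_approx i cp op.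
have e2e : e < 2 * e by lra.
have [q] := rat_in_itvoo e2e.
rewrite in_itv /= => /andP[eq q2e].
pose N := (\max_(x < n) s' x).+1.
have sN x : (x < n)%N -> (s' x < N)%N.
  by move=> xn; rewrite ltnS; apply: (leq_bigmax (F := fun x : 'I_n => s' x) (Ordinal xn)).
(* [Q2] describes a copy of [p i] on the constants from [N] on, in which the old tuple lies within
   [q] of its partners; these are parameters, being below [N]. *)
pose Q2 : seq (qexpr L) := [seq (ren_form (addn N) a.1, a.2) | a <- Q] ++
  [seq (RAtom (Dist (new_const L (N + s x)%N) (new_const L (s' x))), q) | x : 'I_n <- enum 'I_n].
have Q2P (D : interp L) (g : nat -> D) : satq Q2 g <->
    satq Q (g \o addn N) /\ forall x, (x < n)%N -> dist (g (N + s x)%N) (g (s' x)) < ratr q.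
  have renQ : all (fun a => cform g a.1 < ratr a.2) [seq (ren_form (addn N) a.1, a.2) | a <- Q] =
      satq Q (g \o addn N).
    by rewrite all_map; apply: eq_all => a /=; rewrite cform_ren.
  rewrite /satq all_cat renQ; split.
    move=> /andP[h1 /all_enum h2]; split=> [|x xn]; first exact: h1.
    exact: (h2 (Ordinal xn)).
  by move=> [h1 h2]; apply/andP; split; [exact: h1|apply/all_enum => x; exact: h2].
have [n' [[h [hN hh]]|[]]] := ep' N Q2; last first.
  have [D [g1 [g2 [DT h1 h2 h12]]]] := lk l n'.
  (* A common model given by the link realizes [Q2] when its first naming is placed from [N] on, so
     the refuting alternative is impossible. *)
  pose f y := if (y < N)%N then g2 y else g1 (y - N)%N.
  have fN : f \o addn N = g1.
    by apply: funext => y; rewrite /f /= ltnNge leq_addr /= addKn.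
  exists D, g2, f; split=> //; last by move=> y yN; rewrite /f yN.
  apply/Q2P; rewrite fN; split; first exact: pQ.
  move=> x xn; have := congr1 (@^~ (s x)) fN => /= ->.
  by rewrite /f sN //; apply: lt_trans eq; exact: h12.
exists (fun x => h (N + t x)%N); split; last first.
  move=> x xn; have /Q2P [_ /(_ x xn) /=] := hh _ _ (gp' n').
  rewrite (hN _ (sN x xn)) /t ltn_eqF // => /lt_trans; exact.
move=> a b; apply: (@compatible_le _ _ _ _ _ _ (p (maxn a i)) (p' (maxn b n'))).
- exact: chain_le cp _ _ (leq_maxl _ _).
- exact: chain_le cp' _ _ (leq_maxl _ _).
(* Both sides force the isolating [p i]: [p] with its own constants and [p'] with the copied
   ones. *)
have [D [g1 [g2 [DT h1 h2 h12]]]] : compatible m k.+1%:R^-1 (p (maxn a i)) id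
    (p' (maxn b n')) (h \o addn N).
  apply: hi; [exact: cp.1|exact: cp'.1|move=> D g DT|move=> D g DT].
    by apply: sat_sub; exact: chain_le cp _ _ (leq_maxr _ _).
  by move=> /(sat_sub (chain_le cp' (leq_maxr _ _))) /hh /Q2P [/Qp].
exists D, g1, g2; split=> // x xn; apply: lt_trans hk; exact: h12 (tm x xn).
Qed.

(** * Back-and-forth between two generic chains *)

Section Limit.
Variables (p p' : nat -> set (expr L)).
Hypotheses (cp : chain T p) (cp' : chain T p').
Hypotheses (dp : forall a k, exists n, decides a k (p n))
  (dp' : forall a k, exists n, decides a k (p' n)).
Hypotheses (op : forall n phi r, p n (phi, r) -> exists m s, s < r /\ p m (phi, s))
  (op' : forall n phi r, p' n (phi, r) -> exists m s, s < r /\ p' m (phi, s)).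
Hypotheses (ap : forall n k, exists m, isolates n k.+1%:R^-1 (p m))
  (ap' : forall n k, exists m, isolates n k.+1%:R^-1 (p' m)).
Hypotheses (ep : ext_generic T p) (ep' : ext_generic T p').
Variables (M M' : structure L) (g : nat -> M) (g' : nat -> M').
Hypotheses (gp : forall n, sat (p n) g) (gp' : forall n, sat (p' n) g').

(** Each value is decided up to a small error by some condition, and the link gives a common model
    of the two deciding conditions with nearby tuples. *)
Lemma linked_atom n (a : atom L n) (e : R) : 0 < e -> exists2 d, 0 < d &
  forall s s' m (x : 'I_n -> nat), (forall i, (x i < m)%N) -> linked p p' s s' m d ->
  `|eval_atom (g \o s \o x) a - eval_atom (g' \o s' \o x) a| <= e.
Proof.
move=> e0; have e20 : 0 < e / 2 by rewrite divr_gt0.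
have [d d0 hd] := eval_atom_unif a e20; exists d => // s s' m x xm lk.
(* One error below [e / 2] and four below [e / 8] add up to [e]. *)
have e80 : 0 < e / 8 by rewrite divr_gt0.
have [k /(_ k (leqnn _)) hk] := inv_small e80.
have [i [c hc]] := dp (sub_atom (s \o x) a) k.
have [i' [c' hc']] := dp' (sub_atom (s' \o x) a) k.
have [D [g1 [g2 [DT h1 h2 h12]]]] := lk i i'.
have := hd _ (struct_pre D) (g1 \o s \o x) (g2 \o s' \o x) (fun j => h12 _ (xm j)).
have := lt_trans (hc _ _ h1) hk; have := lt_trans (hc _ _ (@gp i)) hk.
have := lt_trans (hc' _ _ h2) hk; have := lt_trans (hc' _ _ (@gp' i')) hk.
rewrite !catom_sub !ltr_norml ler_norml.
move=> /andP[? ?] /andP[? ?] /andP[? ?] /andP[? ?] /andP[? ?].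
by apply/andP; split; rewrite /comp; lra.
Qed.

(* Stage [n] of the back-and-forth treats the constant with this index, on the
   first side if [n] is even and on the second side if [n] is odd. *)
Definition task (n : nat) : nat := logn 2 n./2.+1.

Lemma task_surj (j N : nat) (b : bool) : exists n, [/\ (N <= n)%N, task n = j & odd n = b].
Proof.
(* [m] is to be [n./2.+1]: its 2-adic valuation is [j], and the odd factor makes it large. *)
pose m := (2 ^ j * N.*2.+1)%N.
have m0 : (0 < m)%N by rewrite muln_gt0 expn_gt0.
exists (b + m.-1.*2)%N; split.
- apply: leq_trans (leq_addl _ _); have : (N.*2.+1 <= m)%N by rewrite leq_pmull // expn_gt0.
  by rewrite -!mul2n; case: m m0 => //= m _; lia.
- rewrite /task; have -> : (b + m.-1.*2)./2 = m.-1.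
    by rewrite halfD odd_double andbF doubleK; case: (b).
  rewrite prednK // lognM ?expn_gt0 // pfactorK // [logn 2 N.*2.+1]logn_coprime ?addn0 //.
  by rewrite prime_coprime // dvdn2 /= odd_double.
- by rewrite oddD odd_double addbF oddb.
Qed.

(** A state is a pair of partner tuples whose first [n] entries count at stage [n]. Earlier entries
    may move, but by summable amounts, so every position converges and only the limits correspond
    exactly. *)
Definition bf_step (n : nat) (st st' : (nat -> nat) * (nat -> nat)) : Prop :=
  [/\ linked p p' st'.1 st'.2 n.+1 (geo R n.+1),
      forall x, (x < n)%N -> dist (g (st'.1 x)) (g (st.1 x)) <= 2 * geo R n,
      forall x, (x < n)%N -> dist (g' (st'.2 x)) (g' (st.2 x)) <= 2 * geo R n &
      (if odd n then st'.2 else st'.1) n = task n].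

Lemma bf_step_ex n st : linked p p' st.1 st.2 n (geo R n) -> exists st', bf_step n st st'.
Proof.
case: st => s s' /= lk; have gn := geo_gt0 R n.
have nx x : (x < n)%N -> (x == n) = false by move=> xn; rewrite ltn_eqF.
have [on|on] := boolP (odd n).
  have [t [lt ht]] := forth (task n) cp' cp op' ap' ep gp gn (geo_gt0 R n.+1) (linked_sym lk).
  exists (t, fun x => if x == n then task n else s' x); split=> /=.
  - exact: linked_sym.
  - by move=> x xn; apply/ltW/ht.
  - by move=> x xn; rewrite nx // (distxx (struct_pre M')) mulr_ge0 // ltW.
  - by rewrite on eqxx.
have [t [lt ht]] := forth (task n) cp cp' op ap ep' gp' gn (geo_gt0 R n.+1) lk.
exists (fun x => if x == n then task n else s x, t); split=> //=.
- by move=> x xn; rewrite nx // (distxx (struct_pre M)) mulr_ge0 // ltW.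
- by move=> x xn; apply/ltW/ht.
- by rewrite (negbTE on) eqxx.
Qed.

(** The limits of the positions are dense because every constant is entered at arbitrarily late
    stages, and they have equal atomic values because the links become arbitrarily precise. *)
Lemma back_and_forth : JEP T ->
  (forall (y : M) (e : R), 0 < e -> exists i, dist (g i) y < e) ->
  (forall (y : M') (e : R), 0 < e -> exists i, dist (g' i) y < e) ->
  isomorphic M M'.
Proof.
move=> jep dg dg'; have pM := struct_pre M; have pM' := struct_pre M'.
(* Unlinked states receive the default [st]; they do not occur along the recursion below. *)
have /choice [F hF] : forall a : nat * ((nat -> nat) * (nat -> nat)), exists st',
    linked p p' a.2.1 a.2.2 a.1 (geo R a.1) -> bf_step a.1 a.2 st'.
  move=> [n st] /=; case: (EM (linked p p' st.1 st.2 n (geo R n))) => [/bf_step_ex [st' ?]|?].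
    by exists st'.
  by exists st.
pose fix st n := if n is m.+1 then F (m, st m) else (id, id).
have lk n : linked p p' (st n).1 (st n).2 n (geo R n).
  elim: n => [|n IH] /=; first exact: linked0.
  by have [] := hF (n, st n) IH.
have step n : bf_step n (st n) (st n.+1) by exact: (hF (n, st n) (lk n)).
have /choice [u hu] : forall x, exists l, forall n, (x < n)%N ->
    dist (g ((st n).1 x)) l <= 4 * geo R n.
  move=> x; apply: (@geo_limit _ _ M (fun n => g ((st n).1 x)) x.+1) => n xn.
  by have [_ h _ _] := step n; rewrite (dist_sym pM); exact: h.
have /choice [u' hu'] : forall x, exists l, forall n, (x < n)%N ->
    dist (g' ((st n).2 x)) l <= 4 * geo R n.
  move=> x; apply: (@geo_limit _ _ M' (fun n => g' ((st n).2 x)) x.+1) => n xn.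
  by have [_ _ h _] := step n; rewrite (dist_sym pM'); exact: h.
apply: (@dense_isomorphic _ _ M M' u u').
- move=> y e e0; have e20 : 0 < e / 2 by rewrite divr_gt0.
  have [j hj] := dg y _ e20; have e80 : 0 < e / 8 by rewrite divr_gt0.
  (* The constant [j] is entered at position [n] at a late stage [n]; that position then moves by at
     most [4 * geo n.+1]. *)
  have [N hN] := geo_small e80; have [n [Nn tn on]] := task_surj j N false.
  have [_ _ _] := step n; rewrite on tn => sn.
  exists n; have := hu n n.+1 (leqnn _); rewrite sn; have := hN n.+1 (leqW Nn).
  have := dist_triangle pM (u n) (g j) y; rewrite (dist_sym pM (u n) (g j)); lra.
- move=> y e e0; have e20 : 0 < e / 2 by rewrite divr_gt0.
  have [j hj] := dg' y _ e20; have e80 : 0 < e / 8 by rewrite divr_gt0.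
  have [N hN] := geo_small e80; have [n [Nn tn on]] := task_surj j N true.
  have [_ _ _] := step n; rewrite on tn => sn.
  exists n; have := hu' n n.+1 (leqnn _); rewrite sn; have := hN n.+1 (leqW Nn).
  have := dist_triangle pM' (u' n) (g' j) y; rewrite (dist_sym pM' (u' n) (g' j)); lra.
- move=> l a x; apply/eqP; rewrite -subr_eq0 -normr_le0; apply: le_eps => e e0.
  have e30 : 0 < e / 3 by rewrite divr_gt0.
  have [d d0 hd] := linked_atom a e30; have [c c0 hc] := eval_atom_unif a e30.
  have c40 : 0 < c / 4 by rewrite divr_gt0.
  have [N hN] := geo_small d0; have [N' hN'] := geo_small c40.
  pose n := maxn (\max_i x i).+1 (maxn N N').
  have xn i : (x i < n)%N by rewrite leq_max ltnS leq_bigmax.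
  have nN : (N <= n)%N by rewrite !leq_max leqnn orbT.
  have nN' : (N' <= n)%N by rewrite !leq_max leqnn !orbT.
  have h1 : `|eval_atom (g \o (st n).1 \o x) a - eval_atom (u \o x) a| < e / 3.
    by apply: hc => // i; have := hu _ _ (xn i); have := hN' _ nN'; rewrite /=; lra.
  have h2 : `|eval_atom (g' \o (st n).2 \o x) a - eval_atom (u' \o x) a| < e / 3.
    by apply: hc => // i; have := hu' _ _ (xn i); have := hN' _ nN'; rewrite /=; lra.
  have := hd (st n).1 (st n).2 n x xn; move: h1 h2.
  rewrite !ltr_norml !ler_norml => /andP[? ?] /andP[? ?] h.
  have /andP[? ?] : - (e / 3) <=
      eval_atom (g \o (st n).1 \o x) a - eval_atom (g' \o (st n).2 \o x) a <= e / 3.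
    apply: h => i i'; have [D [f [f' [DT fp fp' ff']]]] := lk n i i'.
    exists D, f, f'; split=> // y yn; apply: lt_trans (ff' _ yn) _; exact: hN.
  by apply/andP; split; lra.
Qed.

End Limit.
End BackAndForth.

(** * The dichotomy *)

(* Koenig: if the fibre [c = n] missed the value [z n] in its [n]-th slice for
   every [n], the sequence with slices [z] would lie in no fibre. *)
Lemma continuum_fibre (Y : Type) (rep : (nat -> bool) -> Y) (c : (nat -> bool) -> nat) :
  (forall x y, rep x = rep y -> c x = c y -> x = y) ->
  exists f : (nat -> bool) -> (nat -> bool), forall x y, rep (f x) = rep (f y) -> x = y.
Proof.
move=> inj; pose slice (n : nat) (x : nat -> bool) (m : nat) := x (pickle (n, m)).
have [n hn] : exists n, forall z, exists x, c x = n /\ slice n x = z.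
  apply: contrapT => none.
  have /choice [z hz] : forall n, exists z, forall x, c x = n -> slice n x <> z.
    move=> n; apply: contrapT => nz; apply: none; exists n => z.
    by apply: contrapT => nx; apply: nz; exists z => x cx sx; apply: nx; exists x.
  pose x k := if unpickle k is Some (n, m) then z n m else false.
  by apply: (hz (c x) x erefl); apply: funext => m; rewrite /slice /x pickleK.
have /choice [f hf] := hn; exists f => x y fxy.
have [cx <-] := hf x; have [cy <-] := hf y.
by rewrite (inj _ _ fxy) // cx cy.
Qed.

Section Dichotomy.
Variables (R : realType) (L : signature R) (T : set (sentence L)).
Local Notation LC := (add_const L).

Lemma isomorphic_refl (A : interp L) : isomorphic A A.
Proof. by exists id; split; [exists id|split]. Qed.

(** A branch is coloured by the indices of constants of its class representative that approximate
    the images of its first [n] constants. Branches of the same class and colour coincide, and there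
    are countably many colours, so [continuum_fibre] applies. *)
Lemma continuum_noniso (F : (nat -> bool) -> structure L) (g : forall x, nat -> F x)
    (n : nat) (e : R) :
  0 < e ->
  (forall x (y : F x) (d : R), 0 < d -> exists i, dist (g x i) y < d) ->
  (forall x y z (h : F x -> F z) (k : F y -> F z), embedding h -> embedding k ->
     (forall i, (i < n)%N -> dist (h (g x i)) (k (g y i)) < e) -> x = y) ->
  exists f : (nat -> bool) -> (nat -> bool),
    forall x y, x <> y -> ~ isomorphic (F (f x)) (F (f y)).
Proof.
move=> e0 dg sep; have e20 : 0 < e / 2 by rewrite divr_gt0.
(* The choice depends only on the isomorphism class as a set; the default is not taken, since the
   class contains [x]. *)
pose rep x := xget (fun=> false) [set y | isomorphic (F x) (F y)].
have repP x : isomorphic (F x) (F (rep x)).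
  by apply: (@xgetPex _ _ [set y | isomorphic (F x) (F y)]); exists x; exact: isomorphic_refl.
have repE x y : isomorphic (F x) (F y) -> rep x = rep y.
  move=> xy; congr xget; apply/seteqP; split=> z /= h; last exact: isomorphic_trans xy h.
  exact: isomorphic_trans (isomorphic_sym xy) h.
pose near_tuple x z (t : {ffun 'I_n -> nat}) := exists2 h : F x -> F z, embedding h &
  forall i : 'I_n, dist (h (g x i)) (g z (t i)) < e / 2.
have /choice [t ht] : forall x, exists t, near_tuple x (rep x) t.
  move=> x; have [h [_ emb]] := repP x.
  have /choice [t ht] : forall i : 'I_n, exists j, dist (h (g x i)) (g (rep x) j) < e / 2.
    move=> i; have [j hj] := dg _ (h (g x i)) _ e20; exists j.
    by rewrite (dist_sym (struct_pre _)).
  by exists [ffun i => t i], h => // i; rewrite ffunE.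
have [x y|f hf] := @continuum_fibre _ rep (fun x => pickle (t x)).
  move=> rxy /(pcan_inj (@pickleK _)) txy.
  have [h eh hh] := ht x; have [k ek hk] : near_tuple y (rep x) (t x) by rewrite rxy txy.
  apply: sep eh ek _ => i i_n; have := hh (Ordinal i_n); have := hk (Ordinal i_n) => /=.
  have pM := struct_pre (F (rep x)).
  have := dist_triangle pM (h (g x i)) (g (rep x) (t x (Ordinal i_n))) (k (g y i)).
  rewrite (dist_sym pM (g _ _)); lra.
by exists f => x y xy fxy; apply: xy; apply: hf; exact: repE.
Qed.

Lemma legal_chain p : (forall n, legal_move T p n) -> chain T p.
Proof.
by move=> lp; split=> n; [have [] := lp n|have [_ h] := lp n.+1; exact: h].
Qed.

(** * Meeting countably many dense sets *)

Section Extension.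
Variable D : nat -> set (set (expr L)).
Hypothesis dD : forall k, dense_below T (D k).

Lemma extension_fun : exists F : nat -> set (expr L) -> set (expr L),
  forall k q, condition T q ->
    [/\ condition T (F k q), q `<=` F k q, D k (F k q) & shrinks q (F k q)].
Proof.
have /choice [F hF] : forall a : nat * set (expr L), exists q, condition T a.2 ->
    [/\ condition T q, a.2 `<=` q, D a.1 q & shrinks a.2 q].
  move=> [k q] /=; case: (EM (condition T q)) => [cq|ncq]; last by exists q.
  by have [q' hq'] := dense_shrinks (dD k) cq; exists q'.
by exists (fun k q => F (k, q)) => k q cq; exact: (hF (k, q)).
Qed.

Definition meets_all (p : nat -> set (expr L)) : Prop :=
  [/\ chain T p, forall k, exists n, D k (p n) &
    forall n phi r, p n (phi, r) -> exists m s, s < r /\ p m (phi, s)].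

Lemma meets_all_ex : satisfiable T -> exists p, meets_all p.
Proof.
move=> [M MT]; have [F hF] := extension_fun; have [x0] := nonempty (struct_pre M).
have c0 : condition T (set0 : set (expr L)).
  by apply/conditionP; split; [exact: finite_set0|exists M, (fun=> x0); split].
pose fix p n := if n is m.+1 then F m (p m) else set0.
have cp n : condition T (p n).
  by elim: n => [//|n IH] /=; have [] := hF n _ IH.
exists p; split; first by split=> // n /=; have [] := hF n _ (cp n).
  by move=> k; exists k.+1 => /=; have [] := hF k _ (cp k).
move=> n phi r pr; have [_ _ _ /(_ _ _ pr) [s sr ps]] := hF n _ (cp n).
by exists n.+1, s.
Qed.

Lemma meets_all_strategy : exists s : strategy L, forall p, follows s p ->
  (forall n, odd n -> (forall m, (m < n)%N -> legal_move T p m) -> legal_move T p n) /\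
  ((forall n, legal_move T p n) -> meets_all p).
Proof.
have [F hF] := extension_fun.
(* The history before move [2k+1] has that length, so halving it gives the index [k] of the dense
   set to enter; [set0] is not reached, the history being nonempty. *)
exists (fun hist => F (size hist)./2 (last set0 hist)) => p fp.
have pS n : odd n.+1 -> p n.+1 = F n.+1./2 (p n).
  move=> on; rewrite (fp _ on) -nth_last size_mkseq /= nth_mkseq //.
split=> [[//|n] on lp|lp].
  have [cp _] := lp n (leqnn _); rewrite /legal_move (pS n on).
  by have [] := hF n.+1./2 _ cp; split=> // m [<-].
have cp := legal_chain lp; split=> //.
  move=> k; exists k.*2.+1; rewrite pS /= ?odd_double // uphalf_double.
  by have [] := hF k _ (cp.1 k.*2).
(* Only the answers of player exists shrink bounds. A bound occurring in such an answer passes to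
   the next move of player forall, and the answer to that one shrinks it. *)
suff op n phi r : odd n.+1 -> p n (phi, r) -> exists m s, s < r /\ p m (phi, s).
  move=> n phi r pr; have [on|/negPn on] := boolP (odd n.+1); first exact: op pr.
  by apply: (op n.+1); [rewrite /= negbK|exact: cp.2].
move=> on pr; have [_ _ _ /(_ _ _ pr) [s sr ps]] := hF n.+1./2 _ (cp.1 n).
by exists n.+1, s; rewrite pS.
Qed.

End Extension.

Hypotheses (countL : countable_signature L) (satT : satisfiable T)
  (aeT : forall_exists_axiomatizable T) (jepT : JEP T).

(** All requirements form one countable family. One sequence meeting them yields the model, and the
    back-and-forth identifies with it the structure compiled from any play meeting them. *)
Lemma atomic_enforceable_model :
  (forall n k, dense_below T (isolates T n k.+1%:R^-1)) ->
  exists A : structure L, enforceable_model T A.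
Proof.
move=> at_; have [c injc] := countable_rformula countL.
pose I : Type := ((atom LC 0 * nat) + (nat * seq (qexpr L)) + (nat * nat))%type.
pose code (i : I) : nat := pickle (match i with
  | inl (inl a) => inl (inl (c (RAtom a.1), a.2))
  | inl (inr b) => inl (inr (b.1, [seq (c e.1, e.2) | e <- b.2]))
  | inr b => inr b end : (nat * nat) + (nat * seq (nat * rat)) + (nat * nat)).
have injcode : injective code.
  move=> i j /(pcan_inj (@pickleK _)).
  case: i j => [[[a k]|[N Q]]|i] [[[a' k']|[N' Q']]|j] //= [].
  - by move=> /injc [->] ->.
  - move=> -> /inj_map QQ; rewrite QQ // => -[x1 x2] [y1 y2] /= [/injc -> ->] //.
  - by move=> ->.
pose D (i : I) : set (set (expr L)) := match i with
  | inl (inl a) => decides a.1 a.2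
  | inl (inr b) => decides_ext T b.1 b.2
  | inr b => isolates T b.1 b.2.+1%:R^-1 end.
have dD i : dense_below T (D i).
  by case: i => [[a|b]|b]; [exact: dense_decides|exact: dense_decides_ext|exact: at_].
have dE := dense_enum injcode dD.
have meets p : meets_all (fun k q => forall i, code i = k -> D i q) p ->
    [/\ forall a k, exists n, decides a k (p n), ext_generic T p &
      forall n k, exists m, isolates T n k.+1%:R^-1 (p m)].
  move=> [_ mp _]; split=> [a k|N Q|n k].
  - by have [m hm] := mp (code (inl (inl (a, k)))); exists m; exact: (hm _ erefl).
  - by have [m hm] := mp (code (inl (inr (N, Q)))); exists m; exact: (hm _ erefl).
  - by have [m hm] := mp (code (inr (n, k))); exists m; exact: (hm _ erefl).
have [p hp] := meets_all_ex dE satT.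
have [cp _ op] := hp; have [dp ep ap] := meets p hp.
have [M [g [MT gp dg]]] := canonical_model cp dp op ep aeT.
exists M; split=> //.
have [s hs] := meets_all_strategy dE; exists s => p' /hs [h1 h2]; split=> // /h2 hp'.
have [cp' _ op'] := hp'; have [dp' ep' ap'] := meets p' hp'.
have [M' [g' [MT' gp' dg']]] := canonical_model cp' dp' op' ep' aeT.
have [defp' compl] := decided_compiled dp' MT' gp' dg'.
split=> //; exists (expand g'); split=> //=.
rewrite reduct_expand.
apply: (back_and_forth cp' cp dp' dp op' op ap' ap ep' ep gp' gp jepT).
  exact: (ext_generic_dense cp' ep' gp' dg').
exact: (ext_generic_dense cp ep gp dg).
Qed.

(* A condition forcing a renamed copy of [q] is carried over, up to a small
   displacement of the first constants, to an actual extension of [q]. *)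
Lemma forces_extension n (e : R) q r f : 0 < e -> finite_set q -> condition T r ->
  forces T r f q ->
  exists r', [/\ condition T r', q `<=` r' & forall (M : interp L) (g : nat -> M), sat r' g ->
    exists2 g0 : nat -> M, sat r g0 & forall x, (x < n)%N -> dist (g x) (g0 (f x)) < e].
Proof.
move=> e0 fq /conditionP [fr [M [g0 [MT hr]]]] rq.
have [K hK] := sat_support fq; pose N := maxn K n.
pose h x := (N + f x)%N.
exists ((q `|` ren_set (addn N) r) `|` close_set id h n e).
(* From [N] on the naming carries a copy of [r]; below [N] it reads the constants through [f], where
   [q] holds, and [close_set] relates the two. *)
pose g x := if (x < N)%N then g0 (f x) else g0 (x - N)%N.
have gN x : g (N + x)%N = g0 x by rewrite /g ltnNge leq_addr /= addKn.
split; first last.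
- move=> M' g' /satU [/satU [_ /sat_ren h1] /sat_close h2].
  by exists (g' \o addn N).
- by move=> x qx; left; left.
have hq : sat q g.
  by apply: hK (rq _ _ MT hr) => x xK; rewrite /g (leq_trans xK (leq_maxl _ _)).
have hren : sat (ren_set (addn N) r) g.
  by apply/sat_ren; have -> : g \o addn N = g0 by apply: funext => x; exact: gN.
apply: (condition_extend (M := M) (g := g)) => //.
- by rewrite finite_setU; split=> //; exact: finite_image.
- exact/finite_image/finite_II.
- exact/satU.
- apply/sat_close => x xn; rewrite gN /g (leq_trans xn (leq_maxr _ _)).
  by rewrite (distxx (struct_pre M)).
Qed.

(** The conditions witnessing non-isolation only force copies of [q]. Replacing each by an extension
    of [q] itself costs [e / 3], which leaves a separation of [e / 3]. *)
Lemma not_isolated_split n (e : R) q : 0 < e -> condition T q -> ~ isolates T n e q ->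
  exists r : bool -> set (expr L), (forall b, condition T (r b) /\ q `<=` r b) /\
    forall b, ~ compatible T n (e / 3) (r b) id (r (~~ b)) id.
Proof.
move=> e0 cq niso; have e30 : 0 < e / 3 by rewrite divr_gt0.
have [r1 [f1 [r2 [f2 [c1 c2 F1 F2 nc]]]]] : exists r1 f1 r2 f2,
    [/\ condition T r1, condition T r2, forces T r1 f1 q, forces T r2 f2 q &
      ~ compatible T n e r1 f1 r2 f2].
  apply: contrapT => none; apply: niso => r1 f1 r2 f2 c1 c2 F1 F2.
  by apply: contrapT => nc; apply: none; exists r1, f1, r2, f2.
have [s1 [cs1 qs1 h1]] := forces_extension n e30 cq.1 c1 F1.
have [s2 [cs2 qs2 h2]] := forces_extension n e30 cq.1 c2 F2.
have nc12 : ~ compatible T n (e / 3) s1 id s2 id.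
  move=> [M [g1 [g2 [MT /h1 [k1 rk1 d1] /h2 [k2 rk2 d2] d12]]]]; apply: nc.
  exists M, k1, k2; split=> // x xn; have := d1 x xn; have := d2 x xn; have := d12 x xn.
  have pM := struct_pre M; rewrite (dist_sym pM (g1 x) (k1 _)).
  have := dist_triangle pM (k1 (f1 x)) (g1 x) (k2 (f2 x)).
  have := dist_triangle pM (g1 x) (g2 x) (k2 (f2 x)); rewrite /=; lra.
exists (fun b => if b then s1 else s2); split; first by case.
case=> //= -[M [g1 [g2 [MT h h' d]]]]; apply: nc12; exists M, g2, g1; split=> // x xn.
by rewrite (dist_sym (struct_pre M)); exact: d.
Qed.

(** * The tree of plays against a winning strategy *)

Section Tree.
Variables (P : property L) (s : strategy L).
Hypothesis ws : winning T (reduct_property P) s.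
Variables (n0 : nat) (e : R) (q0 : set (expr L)).
Hypotheses (e0 : 0 < e) (cq0 : condition T q0).
Hypothesis niso : forall q, condition T q -> q0 `<=` q -> ~ isolates T n0 e q.

(** Player forall spells out a branch [x] against [s], choosing sides of splittings and meeting the
    extension requirements. Every branch is a legal play, so its structure has [P], and distinct
    branches are separated. *)
Lemma many_models_of_splitting : continuum_many (fun M => models T M /\ P M).
Proof.
have [c injc] := countable_rformula countL.
pose code (b : nat * seq (qexpr L)) : nat := pickle (b.1, [seq (c a.1, a.2) | a <- b.2]).
have injcode : injective code.
  move=> [N Q] [N' Q'] /(pcan_inj (@pickleK _)) /= [-> /inj_map QQ].
  by rewrite QQ // => -[x1 x2] [y1 y2] /= [/injc -> ->].
have [F hF] := extension_fun (dense_enum injcode (fun b => @dense_decides_ext R L T b.1 b.2)).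
have /choice [S hS] : forall q, exists r : bool -> set (expr L), condition T q -> q0 `<=` q ->
    (forall b, condition T (r b) /\ q `<=` r b) /\
    forall b, ~ compatible T n0 (e / 3) (r b) id (r (~~ b)) id.
  move=> q; case: (EM (condition T q /\ q0 `<=` q)) => [[cq q0q]|nq].
    by have [r hr] := not_isolated_split e0 cq (niso cq q0q); exists r.
  by exists (fun=> q) => cq q0q; case: nq.
(* Player forall opens with an extension of [q0]; move [2k+2] takes the side [x k] of the splitting
   and then meets requirement [k+1]. *)
pose next x (hist : seq (set (expr L))) :=
  let n := size hist in
  if odd n then s hist else
  if n is 0%N then F 0%N q0 else F n./2 (S (last set0 hist) (x n./2.-1)).
pose fix hist (x : nat -> bool) n :=
  if n is m.+1 then rcons (hist x m) (next x (hist x m)) else [::].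
pose p x n := next x (hist x n).
have histE x n : mkseq (p x) n = hist x n.
  by elim: n => [//|n IH]; rewrite mkseqS IH.
have sz x n : size (hist x n) = n by rewrite -histE size_mkseq.
have fp x : follows s (p x) by move=> n on; rewrite /p /next sz on histE.
have pS x n : odd n -> p x n.+1 = F n.+1./2 (S (p x n) (x n.+1./2.-1)).
  by move=> on; rewrite /p /next sz /= on /= last_rcons.
have p0 x : p x 0%N = F 0%N q0 by [].
(* The answers of [s] are known to be legal only after all earlier moves are, hence a strong
   induction. *)
have legal x n : legal_move T (p x) n /\ q0 `<=` p x n.
  have [n1 nn1] := ubnP n; elim: n1 n nn1 => // n1 IH n; rewrite ltnS => nn1.
  have [on|en] := boolP (odd n).
    have ln : legal_move T (p x) n.
      by apply: (ws (fp x)).1 => // m mn; have [] := IH m (leq_trans mn nn1).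
    split=> //; case: n nn1 on ln => // n nn1 on ln.
    by have [_ h] := IH n nn1; apply: subset_trans h _; exact: ln.2.
  case: n nn1 en => [|n] nn1 en.
    by have [c0 s0 _ _] := hF 0%N _ cq0; rewrite p0.
  have on : odd n by move: en; rewrite /= negbK.
  have [[cn _] qn] := IH n nn1; have [cr _] := hS _ cn qn.
  have [cS nS] := cr (x n.+1./2.-1); have [cF sF _ _] := hF n.+1./2 _ cS.
  have pn : p x n `<=` p x n.+1.
    by rewrite (pS x n on); apply: subset_trans nS sF.
  split; last exact: subset_trans qn pn.
  by split=> [|m [<-]] //; rewrite (pS x n on).
have cp x : chain T (p x) by apply: legal_chain => n; have [] := legal x n.
have ep x : ext_generic T (p x).
  move=> N Q; pose k := code (N, Q).
  suff : exists n, forall b, code b = k -> decides_ext T b.1 b.2 (p x n).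
    by move=> [n hn]; exists n; exact: (hn (N, Q)).
  exists k.*2; case: k => [|k]; first by have [_ _ h _] := hF 0%N _ cq0; rewrite p0.
  have [[cn _] qn] := legal x k.*2.+1; have [cr _] := hS _ cn qn.
  have [cS nS] := cr (x k.*2.+2./2.-1); have [_ _ h _] := hF k.*2.+2./2 _ cS.
  have E : k.*2.+2./2 = k.+1 by rewrite /= doubleK.
  by rewrite doubleS (pS x) ?E; [rewrite E in h|rewrite /= odd_double].
have sep x y (M : structure L) (f g : nat -> M) : models T M ->
    (forall n, sat (p x n) f) -> (forall n, sat (p y n) g) ->
    (forall i, (i < n0)%N -> dist (f i) (g i) < e / 3) -> x = y.
  move=> MT hf hg fg; apply: contrapT => xy.
  have ex : exists i, x i != y i.
    apply: contrapT => none; apply: xy; apply: funext => i; apply/eqP; apply: contrapT => /negP xyi.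
    by apply: none; exists i.
  have [i xyi least] := ex_minnP ex.
  (* Through move [2i+1] the plays use only values of the branches below the first disagreement [i];
     move [2i+2] takes opposite sides. *)
  have hist_eq n : (n <= i.+1.*2)%N -> hist x n = hist y n.
    elim: n => [//|n IH] ni /=; rewrite IH ?(ltnW ni) //; congr rcons; rewrite /next sz.
    case: ifP => // on; case: n {IH} ni on => [//|n] ni on.
    congr (F _ (S _ _)); apply/eqP; apply: contrapT => /negP /least; lia.
  have pe : p x i.*2.+1 = p y i.*2.+1.
    have := hist_eq i.+1.*2 (leqnn _); rewrite doubleS /= => /rcons_inj [_].
    by [].
  have [[cn _] qn] := legal x i.*2.+1; have [cr ncr] := hS _ cn qn.
  have sub z : p z i.*2.+1 = p x i.*2.+1 -> S (p x i.*2.+1) (z i) `<=` p z i.*2.+2.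
    move=> pz; have [cS _] := cr (z i); have [_ h _ _] := hF i.+1 _ cS.
    have E : i.*2.+2./2 = i.+1 by rewrite /= doubleK.
    by rewrite (pS z) ?E ?pz //= odd_double.
  apply: (ncr (x i)); exists M, f, g; split=> //.
    by apply: sat_sub (hf _); exact: sub.
  have -> : ~~ x i = y i by move: xyi; case: (x i); case: (y i).
  by apply: sat_sub (hg _); apply: sub.
(* The strategy guarantees only [P]; that the compiled structure is a model of [T] comes from the
   extension requirements. *)
have /choice [A hA] : forall x, exists A : {M : structure L & nat -> M},
    [/\ models T (tag A), P (tag A), forall n, sat (p x n) (tagged A) &
      forall (y : tag A) (d : R), 0 < d -> exists i, dist (tagged A i) y < d].
  move=> x; have lx n : legal_move T (p x) n by have [] := legal x n.
  have [defp [M [compl PM]]] := (ws (fp x)).2 lx.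
  have [sP dM] := compiled_consts defp compl.
  have sp n : sat (p x n) (consts M : nat -> reduct M).
    by apply: sat_sub sP => a pa; exists n.
  have dc := ext_generic_dense (cp x) (ep x) sp dM.
  exists (existT _ (reduct M) (consts M)); split=> //=.
  exact: (ext_generic_models (cp x) (ep x) sp aeT dc).
have e30 : 0 < e / 3 by rewrite divr_gt0.
have [x y z d||f hf] := @continuum_noniso (fun x => tag (A x)) (fun x => tagged (A x)) n0 _ e30.
- by have [_ _ _ h] := hA x; exact: h.
- move=> x y z h k eh ek; have [AT _ _ _] := hA z.
  apply: sep AT _ _ => n; apply/sat_emb => //.
    by have [_ _ h' _] := hA x; exact: h'.
  by have [_ _ h' _] := hA y; exact: h'.
exists (fun x => tag (A (f x))); split=> // x; have [? ? _ _] := hA (f x); split=> //.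
Qed.

End Tree.
End Dichotomy.

(** For unsatisfiable [T] both alternatives would fail: without a legal first move every property is
    vacuously enforceable, while there are no models. *)
Theorem theorem6p1 (R : realType) (L : signature R) (T : set (sentence L))
    (countL : countable_signature L)
    (satT : satisfiable T)
    (aeT : forall_exists_axiomatizable T)
    (jepT : JEP T) :
  let many_models := forall P : property L, enforceable T (reduct_property P) ->
    continuum_many (fun M => models T M /\ P M) in
  let has_enforceable_model := exists A : structure L, enforceable_model T A in
  (many_models /\ ~ has_enforceable_model) \/
  (~ many_models /\ has_enforceable_model).
Proof.
move=> many has.
(* Being isomorphic to an enforceable model is itself an enforceable property, and any two
   structures with it are isomorphic. *)
have excl : ~ (many /\ has).
  move=> [m [A [_ enfA]]]; have [F [FA Fne]] := m _ enfA.
  apply: (Fne (fun=> true) (fun=> false)).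
    by move=> /(congr1 (@^~ 0%N)).
  have [_ h1] := FA (fun=> true); have [_ h2] := FA (fun=> false).
  exact: isomorphic_trans h1 (isomorphic_sym h2).
suff [hm|hh] : many \/ has.
- by left; split=> // hh; apply: excl.
- by right; split=> // hm; apply: excl.
case: (EM (forall n k, dense_below T (isolates T n k.+1%:R^-1))) => [at_|nat_].
  by right; exact: atomic_enforceable_model.
left=> P [s ws].
have [n [k [q [cq hq]]]] : exists n k q, condition T q /\
    forall q', condition T q' -> q `<=` q' -> ~ isolates T n k.+1%:R^-1 q'.
  apply: contrapT => none; apply: nat_ => n k q cq; apply: contrapT => nq.
  apply: none; exists n, k, q; split=> // q' cq' qq' iq'.
  by apply: nq; exists q'.
apply: (many_models_of_splitting countL aeT ws _ cq hq).
by rewrite invr_gt0.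
Qed.
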